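(* Let $R$ be a commutative ring with unit, let $H$ be a cocommutative Hopf algebra over $R$, and let $H\text{-}\mathrm{Mod}$ be the symmetric monoidal category of $H$-modules. Let $\mathbb{B}$ be the category of monoids in $H\text{-}\mathrm{Mod}$, and let $\mathbb{E}$ be the global category of rings and modules built from $H\text{-}\mathrm{Mod}$, whose objects are pairs $(M,A)$ with $A\in\mathbb{B}$ and $M$ an $A$-module object in $H\text{-}\mathrm{Mod}$. Then the functor $\pi:\mathbb{E}\to\mathbb{B}$ given by $\pi(M,A)=A$ is both a fibration and a cofibration (i.e. it is a bifibration).
   Context: The tensor product of $H$-modules is the tensor product over $R$ with $H$ acting through its comultiplication; the unit object is $R$, with $H$ acting through the counit. A morphism $(L,A)\to(M,B)$ in $\mathbb{E}$ is a pair $(\alpha,f)$, where $f:A\to B$ is a morphism of monoids in $H\text{-}\mathrm{Mod}$ and $\alpha:L\to f^*M$ is a morphism of $A$-modules in $H\text{-}\mathrm{Mod}$; here $f^*M$ is $M$ regarded as an $A$-module by restriction along $f$. On morphisms, $\pi(\alpha,f)=f$. A functor $\pi:\mathbb{E}\to\mathbb{B}$ is a fibration if for every morphism $f:A\to B$ in $\mathbb{B}$ and every object $N$ of $\mathbb{E}$ with $\pi(N)=B$ there is a (cartesian) lift $f':M\to N$ in $\mathbb{E}$ with $\pi(f')=f$ such that for every $k:M'\to N$ with $\pi(k)=f$ there is a unique morphism $u:M'\to M$ with $\pi(u)=1_A$ and $f'u=k$; moreover, composites of such cartesian lifts are again cartesian lifts. A cofibration is defined dually, i.e. $\pi$ is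 a cofibration if $\pi^{\mathrm{op}}:\mathbb{E}^{\mathrm{op}}\to\mathbb{B}^{\mathrm{op}}$ is a fibration. *)

(* Defs.v *)
From HB Require Import structures.
From mathcomp Require Import all_boot all_algebra.
From mathcomp Require Import boolp.

Set Implicit Arguments.
Unset Strict Implicit.
Unset Printing Implicit Defensive.

Import GRing.Theory.
Local Open Scope quotient_scope.
Local Open Scope ring_scope.

Lemma lin_eq (R : pzRingType) (U V : lmodType R) (f g : {linear U -> V}) :
  f =1 g -> f = g.
Proof.
case: f g => [f [[f1] [f2]]] [g [[g1] [g2]]] /= /funext e; subst g.
by rewrite (Prop_irrelevance f1 g1) (Prop_irrelevance f2 g2).
Qed.

Section Lin.
Variables (R : pzRingType) (U V W : lmodType R).

Lemma linear_comp (f : U -> V) (g : V -> W) :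
  linear f -> linear g -> linear (g \o f).
Proof. by move=> lf lg a u v /=; rewrite lf lg. Qed.

Lemma linear_lin (f : {linear U -> V}) : linear f.
Proof. exact: linearP. Qed.

Lemma lin_D (f : U -> V) : linear f -> {morph f : x y / x + y}.
Proof. by move=> /GRing.semilinear_linear[]. Qed.

Lemma lin_Z (f : U -> V) : linear f -> forall a, {morph f : x / a *: x}.
Proof. by move=> /GRing.semilinear_linear[]. Qed.

Lemma lin_0 (f : U -> V) : linear f -> f 0 = 0.
Proof. by move=> lf; rewrite -(scale0r 0) (lin_Z lf) scale0r. Qed.

Lemma lin_N (f : U -> V) : linear f -> {morph f : x / - x}.
Proof. by move=> lf x; rewrite -scaleN1r (lin_Z lf) scaleN1r. Qed.

Lemma lin_sum (f : U -> V) I (s : seq I) (F : I -> U) :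
  linear f -> f (\sum_(i <- s) F i) = \sum_(i <- s) f (F i).
Proof.
move=> lf; elim: s => [|i s IH]; first by rewrite !big_nil lin_0.
by rewrite !big_cons (lin_D lf) IH.
Qed.

End Lin.

Section Tensor.
Variable R : comPzRingType.

Definition bilinear_map (M N P : lmodType R) (b : M -> N -> P) : Prop :=
  (forall n, linear (b^~ n)) /\ (forall m, linear (b m)).

Section Def.
Variables M N : lmodType R.

Definition formal_eval (P : lmodType R) (b : M -> N -> P) (s : seq (M * N)) : P :=
  \sum_(p <- s) b p.1 p.2.

(* M (x)_R N is the quotient of the finite formal sums of pairs, where two
   sums are identified when no bilinear map separates them; the universal
   property is tlift_pure, tlift_linear and tens_ext below. *)
Definition formal_eq : rel (seq (M * N)) := fun s t =>
  `[< forall (P : lmodType R) (b : M -> N -> P),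
        bilinear_map b -> formal_eval b s = formal_eval b t >].

Lemma formal_eq_refl : reflexive formal_eq.
Proof. by move=> s; apply/asboolP. Qed.

Lemma formal_eq_sym : symmetric formal_eq.
Proof. by move=> s t; apply/asboolP/asboolP => e P b hb; rewrite e. Qed.

Lemma formal_eq_trans : transitive formal_eq.
Proof.
move=> t s u /asboolP e1 /asboolP e2; apply/asboolP => P b hb.
by rewrite e1 // e2.
Qed.

Canonical formal_equiv :=
  EquivRel formal_eq formal_eq_refl formal_eq_sym formal_eq_trans.

Definition tens : Type := {eq_quot formal_equiv}.
HB.instance Definition _ := Choice.on tens.
HB.instance Definition _ := EqQuotient.on tens.

Definition tpure (m : M) (n : N) : tens := \pi_tens [:: (m, n)].

(* The map induced by b; meaningful when b is bilinear. *)
Definition tlift (P : lmodType R) (b : M -> N -> P) (t : tens) : P :=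
  formal_eval b (repr t).

Lemma tlift_pi (P : lmodType R) (b : M -> N -> P) s :
  bilinear_map b -> tlift b (\pi_tens s) = formal_eval b s.
Proof.
move=> hb; have /eqP: \pi_tens (repr (\pi_tens s)) = \pi_tens s by rewrite reprK.
by rewrite -[_ == _]/(\pi_{eq_quot formal_equiv} _ == \pi_{eq_quot formal_equiv} _)
  eqmodE => /asboolP /(_ P b hb).
Qed.

Lemma tlift_inj (s t : tens) :
  (forall (P : lmodType R) (b : M -> N -> P),
     bilinear_map b -> tlift b s = tlift b t) -> s = t.
Proof.
move=> e; rewrite -[s]reprK -[t]reprK; apply/eqP.
rewrite -[_ == _]/(\pi_{eq_quot formal_equiv} _ == \pi_{eq_quot formal_equiv} _).
by rewrite eqmodE; apply/asboolP.
Qed.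

Definition tens_zero : tens := \pi_tens [::].
Definition tens_add (s t : tens) : tens := \pi_tens (repr s ++ repr t).
Definition tens_scale (a : R) (t : tens) : tens :=
  \pi_tens [seq (a *: p.1, p.2) | p <- repr t].
Definition tens_opp (t : tens) : tens := tens_scale (-1) t.

Lemma tlift0' (P : lmodType R) (b : M -> N -> P) :
  bilinear_map b -> tlift b tens_zero = 0.
Proof. by move=> hb; rewrite tlift_pi // /formal_eval big_nil. Qed.

Lemma tliftD' (P : lmodType R) (b : M -> N -> P) s t :
  bilinear_map b -> tlift b (tens_add s t) = tlift b s + tlift b t.
Proof. by move=> hb; rewrite tlift_pi // /formal_eval big_cat. Qed.

Lemma tliftZ' (P : lmodType R) (b : M -> N -> P) a t :
  bilinear_map b -> tlift b (tens_scale a t) = a *: tlift b t.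
Proof.
move=> hb; rewrite tlift_pi // /formal_eval big_map scaler_sumr.
by apply: eq_bigr => p _; rewrite (lin_Z (hb.1 _)).
Qed.

Lemma tens_addA : associative tens_add.
Proof. by move=> s t u; apply: tlift_inj => P b hb; rewrite !tliftD' // addrA. Qed.
Lemma tens_addC : commutative tens_add.
Proof. by move=> s t; apply: tlift_inj => P b hb; rewrite !tliftD' // addrC. Qed.
Lemma tens_add0 : left_id tens_zero tens_add.
Proof. by move=> s; apply: tlift_inj => P b hb; rewrite tliftD' // tlift0' // add0r. Qed.
Lemma tens_addN : left_inverse tens_zero tens_opp tens_add.
Proof.
move=> s; apply: tlift_inj => P b hb.
by rewrite tliftD' // tlift0' // tliftZ' // scaleN1r addNr.
Qed.

HB.instance Definition _ :=
  GRing.isZmodule.Build tens tens_addA tens_addC tens_add0 tens_addN.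

Lemma tens_scaleA a b t : tens_scale a (tens_scale b t) = tens_scale (a * b) t.
Proof. by apply: tlift_inj => P f hf; rewrite !tliftZ' // scalerA. Qed.
Lemma tens_scale1 : left_id 1 tens_scale.
Proof. by move=> t; apply: tlift_inj => P f hf; rewrite !tliftZ' // scale1r. Qed.
Lemma tens_scaleDr : right_distributive tens_scale +%R.
Proof.
move=> a s t; apply: tlift_inj => P f hf.
by rewrite !(tliftZ', tliftD') // scalerDr.
Qed.
Lemma tens_scaleDl t : {morph tens_scale^~ t : a b / a + b}.
Proof.
move=> a b; apply: tlift_inj => P f hf.
by rewrite !(tliftZ', tliftD') // scalerDl.
Qed.

HB.instance Definition _ := GRing.Zmodule_isLmodule.Build R tens
  tens_scaleA tens_scale1 tens_scaleDr tens_scaleDl.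

Lemma tlift_linear (P : lmodType R) (b : M -> N -> P) :
  bilinear_map b -> linear (tlift b).
Proof. by move=> hb a s t; rewrite tliftD' // tliftZ'. Qed.

Lemma tlift_pure (P : lmodType R) (b : M -> N -> P) m n :
  bilinear_map b -> tlift b (tpure m n) = b m n.
Proof. by move=> hb; rewrite tlift_pi // /formal_eval big_seq1. Qed.

Lemma tpure_bilinear : bilinear_map tpure.
Proof.
split=> x a u v; apply: tlift_inj => P b hb;
by rewrite (tlift_linear hb) !tlift_pure // (hb.1, hb.2).
Qed.

Lemma tens_sum (t : tens) : t = \sum_(p <- repr t) tpure p.1 p.2.
Proof.
apply: tlift_inj => P b hb; rewrite (lin_sum _ _ (tlift_linear hb)).
by apply: eq_bigr => p _; rewrite tlift_pure.
Qed.

Lemma tens_ext (P : lmodType R) (f g : tens -> P) : linear f -> linear g ->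
  (forall m n, f (tpure m n) = g (tpure m n)) -> f =1 g.
Proof.
move=> lf lg e t; rewrite (tens_sum t) !lin_sum //.
by apply: eq_bigr => p _; apply: e.
Qed.

End Def.
End Tensor.

Reserved Notation "x ⊗ y" (at level 40, left associativity).
Notation "x ⊗ y" := (tpure x y) : ring_scope.

Section TensorMaps.
Variable R : comPzRingType.
Implicit Types M N P Q : lmodType R.

Lemma bilinear_comp M N M' N' P (b : M' -> N' -> P) (f : M -> M') (g : N -> N') :
  bilinear_map b -> linear f -> linear g ->
  bilinear_map (fun m n => b (f m) (g n)).
Proof.
by move=> hb lf lg; split=> x a u v /=; rewrite ?lf ?lg ?(hb.1 _) ?(hb.2 _).
Qed.

Lemma linear_bilinear M N P Q (b : M -> N -> P) (f : P -> Q) :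
  bilinear_map b -> linear f -> bilinear_map (fun m n => f (b m n)).
Proof. by move=> hb lf; split=> x a u v /=; rewrite ?(hb.1 _) ?(hb.2 _) lf. Qed.

Lemma bilinear_swap M N P (b : M -> N -> P) :
  bilinear_map b -> bilinear_map (fun n m => b m n).
Proof. by case. Qed.

Lemma tlift_param M N P Q (c : Q -> M -> N -> P) t :
  (forall m n, linear (fun a => c a m n)) -> linear (fun a => tlift (c a) t).
Proof.
move=> hc k a b; rewrite /tlift /formal_eval scaler_sumr -big_split.
by apply: eq_bigr => p _; rewrite /= hc.
Qed.

Lemma tlift_bilinear M N P Q (c : Q -> M -> N -> P) :
  (forall a, bilinear_map (c a)) -> (forall m n, linear (fun a => c a m n)) ->
  bilinear_map (fun t a => tlift (c a) t).
Proof.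
by move=> hb hc; split=> [a|t]; [apply: tlift_linear | apply: tlift_param].
Qed.

Definition tmap M N M' N' (f : M -> M') (g : N -> N') : tens M N -> tens M' N' :=
  tlift (fun m n => f m ⊗ g n).

Lemma tmap_bilinear M N M' N' (f : M -> M') (g : N -> N') :
  linear f -> linear g -> bilinear_map (fun m n => f m ⊗ g n).
Proof. exact: bilinear_comp (tpure_bilinear _ _). Qed.

Lemma tmap_linear M N M' N' (f : M -> M') (g : N -> N') :
  linear f -> linear g -> linear (tmap f g).
Proof. by move=> lf lg; apply: tlift_linear; apply: tmap_bilinear. Qed.

Lemma tmap_pure M N M' N' (f : M -> M') (g : N -> N') m n :
  linear f -> linear g -> tmap f g (m ⊗ n) = f m ⊗ g n.
Proof. by move=> lf lg; rewrite /tmap tlift_pure //; apply: tmap_bilinear. Qed.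

Definition tassoc M N P : tens (tens M N) P -> tens M (tens N P) :=
  tlift (fun t p => tlift (fun m n => m ⊗ (n ⊗ p)) t).

Definition tassoc_inv M N P : tens M (tens N P) -> tens (tens M N) P :=
  tlift (fun m t => tlift (fun n p => (m ⊗ n) ⊗ p) t).

Definition tswap M N : tens M N -> tens N M := tlift (fun m n => n ⊗ m).

Lemma tassoc_bil1 M N P (p : P) :
  bilinear_map (fun (m : M) (n : N) => m ⊗ (n ⊗ p)).
Proof.
have [b1 b2] := tpure_bilinear M (tens N P); have [c1 c2] := tpure_bilinear N P.
by split=> x a u v /=; rewrite ?c1 ?b1 ?b2.
Qed.

Lemma tassoc_bil M N P :
  bilinear_map (fun t (p : P) => tlift (fun (m : M) (n : N) => m ⊗ (n ⊗ p)) t).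
Proof.
apply: tlift_bilinear => [p|m n]; first exact: tassoc_bil1.
have [b1 b2] := tpure_bilinear M (tens N P); have [c1 c2] := tpure_bilinear N P.
by move=> a u v /=; rewrite c2 b2.
Qed.

Lemma tassoc_linear M N P : linear (@tassoc M N P).
Proof. exact/tlift_linear/tassoc_bil. Qed.

Lemma tassoc_pure M N P (m : M) (n : N) (p : P) :
  tassoc ((m ⊗ n) ⊗ p) = m ⊗ (n ⊗ p).
Proof.
rewrite /tassoc (tlift_pure _ _ (tassoc_bil _ _ _)).
by rewrite (tlift_pure _ _ (tassoc_bil1 _ _ _)).
Qed.

Lemma tassoc_inv_bil1 M N P (m : M) :
  bilinear_map (fun (n : N) (p : P) => (m ⊗ n) ⊗ p).
Proof.
have [b1 b2] := tpure_bilinear (tens M N) P; have [c1 c2] := tpure_bilinear M N.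
by split=> x a u v /=; rewrite ?c2 ?b1 ?b2.
Qed.

Lemma tassoc_inv_bil M N P :
  bilinear_map (fun (m : M) t => tlift (fun (n : N) (p : P) => (m ⊗ n) ⊗ p) t).
Proof.
apply: bilinear_swap; apply: tlift_bilinear => [m|n p]; first exact: tassoc_inv_bil1.
have [b1 b2] := tpure_bilinear (tens M N) P; have [c1 c2] := tpure_bilinear M N.
by move=> a u v /=; rewrite c1 b1.
Qed.

Lemma tassoc_inv_linear M N P : linear (@tassoc_inv M N P).
Proof. exact/tlift_linear/tassoc_inv_bil. Qed.

Lemma tassoc_inv_pure M N P (m : M) (n : N) (p : P) :
  tassoc_inv (m ⊗ (n ⊗ p)) = (m ⊗ n) ⊗ p.
Proof.
rewrite /tassoc_inv (tlift_pure _ _ (tassoc_inv_bil _ _ _)).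
by rewrite (tlift_pure _ _ (tassoc_inv_bil1 _ _ _)).
Qed.

Lemma tswap_linear M N : linear (@tswap M N).
Proof. exact/tlift_linear/bilinear_swap/tpure_bilinear. Qed.

Lemma tswap_pure M N (m : M) (n : N) : tswap (m ⊗ n) = n ⊗ m.
Proof. by rewrite /tswap tlift_pure //; exact/bilinear_swap/tpure_bilinear. Qed.

Lemma tens_ind M N (S : tens M N -> Prop) :
  (forall m n, S (m ⊗ n)) -> (forall s t, S s -> S t -> S (s + t)) ->
  forall t, S t.
Proof.
move=> Sp SD t; rewrite (tens_sum t); elim: (repr t) => [|p s IH].
  by rewrite big_nil -(lin_0 ((tpure_bilinear M N).2 0)).
by rewrite big_cons; apply: SD.
Qed.

End TensorMaps.

(* An R-algebra given by its unit map R -> A, a ring morphism with central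
   image. The library's algType requires 1 != 0, which would rule out R = 0. *)
Record ralgebra (R : comPzRingType) := RAlgebra {
  alg_ring :> pzRingType;
  alg_unit : {rmorphism R -> alg_ring};
  alg_central : forall a x, alg_unit a * x = x * alg_unit a }.

(* The R-module underlying a module over an R-algebra. *)
Definition res (R : comPzRingType) (H : ralgebra R) (M : lmodType H) : Type := M.

Section Res.
Variables (R : comPzRingType) (H : ralgebra R) (M : lmodType H).

HB.instance Definition _ := GRing.Zmodule.on (res M).

Definition res_scale (a : R) (m : res M) : res M := alg_unit H a *: (m : M).

Lemma res_scaleA a b m : res_scale a (res_scale b m) = res_scale (a * b) m.
Proof. by rewrite /res_scale scalerA rmorphM. Qed.
Lemma res_scale1 : left_id 1 res_scale.
Proof. by move=> m; rewrite /res_scale rmorph1 scale1r. Qed.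
Lemma res_scaleDr : right_distributive res_scale +%R.
Proof. by move=> a m n; rewrite /res_scale scalerDr. Qed.
Lemma res_scaleDl m : {morph res_scale^~ m : a b / a + b}.
Proof. by move=> a b; rewrite /res_scale rmorphD scalerDl. Qed.

HB.instance Definition _ := GRing.Zmodule_isLmodule.Build R (res M)
  res_scaleA res_scale1 res_scaleDr res_scaleDl.

End Res.

Section ResTheory.
Variables (R : comPzRingType) (H : ralgebra R).
Implicit Types M N : lmodType H.

Lemma res_scaleE M (a : R) (m : M) : a *: (m : res M) = alg_unit H a *: m.
Proof. by []. Qed.

Lemma act_linear M (h : H) : linear (fun m : res M => h *: (m : M) : res M).
Proof.
move=> a m n; rewrite [LHS]scalerDr; congr (_ + _).
by rewrite !res_scaleE !scalerA alg_central.
Qed.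

Lemma act_linearl M (m : M) : linear (fun h : res H^o => (h : H) *: m : res M).
Proof.
move=> a h k; rewrite [LHS]scalerDl; congr (_ + _).
exact: esym (scalerA (alg_unit H a) (h : H) m).
Qed.

Lemma res_linear M N (f : M -> N) :
  linear f -> linear (f : res M -> res N).
Proof. by move=> lf a x y; rewrite /= !res_scaleE -lf. Qed.

End ResTheory.

Section Tact.
Variables (R : comPzRingType) (H : ralgebra R).
Implicit Types M N : lmodType H.

Definition HH : lmodType R := tens (res H^o) (res H^o).

(* The action of H (x) H on M (x) N: (a ⊗ b)(m ⊗ n) = a m ⊗ b n. *)
Definition tact M N (s : HH) (t : tens (res M) (res N)) : tens (res M) (res N) :=
  tlift (fun a b : res H^o =>
    tmap (fun m : res M => (a : H) *: (m : M) : res M)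
         (fun n : res N => (b : H) *: (n : N) : res N) t) s.

(* The multiplication of the algebra H (x) H. *)
Definition tmul (s t : HH) : HH := @tact H^o H^o s t.

Lemma tact_bil1 M N (t : tens (res M) (res N)) :
  bilinear_map (fun a b : res H^o =>
    tmap (fun m : res M => (a : H) *: (m : M) : res M)
         (fun n : res N => (b : H) *: (n : N) : res N) t).
Proof.
have [b1 b2] := tpure_bilinear (res M) (res N).
by split=> x; apply: tlift_param => m n a u v /=;
  rewrite (act_linearl, act_linearl) ?b1 ?b2.
Qed.

Lemma tact_linearr M N (s : HH) : linear (@tact M N s).
Proof.
have [b1 b2] := tpure_bilinear (res M) (res N).
apply: (tlift_param (c := fun t (a b : res H^o) =>
    tmap (fun m : res M => (a : H) *: (m : M) : res M)
         (fun n : res N => (b : H) *: (n : N) : res N) t)) => a b.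
by apply: tmap_linear; apply: act_linear.
Qed.

Lemma tact_linearl M N (t : tens (res M) (res N)) : linear (fun s => tact s t).
Proof. exact/tlift_linear/tact_bil1. Qed.

Lemma tact_pure M N (a b : H) (m : M) (n : N) :
  tact ((a : res H^o) ⊗ (b : res H^o)) ((m : res M) ⊗ (n : res N))
  = (a *: m : res M) ⊗ (b *: n : res N).
Proof.
rewrite /tact (tlift_pure _ _ (tact_bil1 _)).
by rewrite tmap_pure //; apply: act_linear.
Qed.

Lemma tactA M N (s t : HH) (u : tens (res M) (res N)) :
  tact (tmul s t) u = tact s (tact t u).
Proof.
elim/tens_ind: u => [m n|u v eu ev]; last first.
  by rewrite (lin_D (tact_linearr _)) eu ev !(lin_D (tact_linearr _)).
elim/tens_ind: t => [c d|t v et ev]; last first.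
  by rewrite /tmul (lin_D (tact_linearr _)) !(lin_D (tact_linearl _)) et ev
    (lin_D (tact_linearr _)).
elim/tens_ind: s => [a b|s v es ev]; last first.
  by rewrite /tmul !(lin_D (tact_linearl _)) es ev.
by rewrite /tmul !tact_pure !scalerA.
Qed.

Lemma tact1 M N (t : tens (res M) (res N)) :
  tact (((1 : H) : res H^o) ⊗ ((1 : H) : res H^o)) t = t.
Proof.
elim/tens_ind: t => [m n|s t es et]; last by rewrite (lin_D (tact_linearr _)) es et.
by rewrite tact_pure !scale1r.
Qed.

End Tact.

(* In Sweedler notation, antipodel reads  sum S(h1) h2 = eps(h) 1. *)
Record hopfAlgebra (R : comPzRingType) := HopfAlgebra {
  hopf_alg :> ralgebra R;
  comul : {linear res hopf_alg^o -> HH hopf_alg};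
  counit : {rmorphism hopf_alg -> R};
  counit_alg : forall a, counit (alg_unit hopf_alg a) = a;
  comul1 : comul (1 : hopf_alg) =
    ((1 : hopf_alg) : res hopf_alg^o) ⊗ ((1 : hopf_alg) : res hopf_alg^o);
  comulM : forall h k : hopf_alg, comul (h * k) = tmul (comul h) (comul k);
  comulA : forall h, tassoc (tmap comul id (comul h)) = tmap id comul (comul h);
  counitl : forall h : hopf_alg,
    tlift (fun a b : res hopf_alg^o => counit a *: b) (comul h) = h;
  counitr : forall h : hopf_alg,
    tlift (fun a b : res hopf_alg^o => counit b *: a) (comul h) = h;
  antipode : {linear res hopf_alg^o -> res hopf_alg^o};
  antipodel : forall h : hopf_alg,
    tlift (fun a b : res hopf_alg^o => (antipode a * b : hopf_alg) : res hopf_alg^o)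
      (comul h) = alg_unit hopf_alg (counit h);
  antipoder : forall h : hopf_alg,
    tlift (fun a b : res hopf_alg^o => (a * antipode b : hopf_alg) : res hopf_alg^o)
      (comul h) = alg_unit hopf_alg (counit h) }.

Definition cocommutative (R : comPzRingType) (H : hopfAlgebra R) : Prop :=
  forall h : H, tswap (comul H h) = comul H h.

Declare Scope cat_scope.
Delimit Scope cat_scope with cat.
Reserved Notation "g ∘ f" (at level 40, left associativity).
Reserved Notation "x ⊠ y" (at level 38, left associativity).
Reserved Notation "f ⊠h g" (at level 38, left associativity).

Record category := Category {
  ob :> Type;
  mor : ob -> ob -> Type;
  idc : forall x, mor x x;
  ccomp : forall x y z, mor y z -> mor x y -> mor x z;
  comp1c : forall x y (f : mor x y), ccomp (idc y) f = f;
  compc1 : forall x y (f : mor x y), ccomp f (idc x) = f;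
  compA : forall x y z t (h : mor z t) (g : mor y z) (f : mor x y),
    ccomp h (ccomp g f) = ccomp (ccomp h g) f }.

Arguments idc {c} x.
Arguments ccomp {c x y z} g f.
Notation "g ∘ f" := (ccomp g f) : cat_scope.
Local Open Scope cat_scope.

Definition op_cat (C : category) : category :=
  @Category C (fun x y => @mor C y x) (@idc C) (fun x y z g f => f ∘ g)
    (fun x y f => compc1 f) (fun x y f => comp1c f)
    (fun x y z t h g f => esym (compA f g h)).

Record functor (C D : category) := Functor {
  fob :> C -> D;
  fmap : forall x y, mor x y -> mor (fob x) (fob y);
  fmap1 : forall x, fmap (idc x) = idc (fob x);
  fmap_comp : forall x y z (g : mor y z) (f : mor x y),
    fmap (g ∘ f) = fmap g ∘ fmap f }.

Arguments fmap {C D} _ {x y} _.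

Definition op_functor (C D : category) (F : functor C D) :
  functor (op_cat C) (op_cat D) :=
  @Functor (op_cat C) (op_cat D) F (fun x y (f : @mor C y x) => fmap F f)
    (fmap1 F) (fun x y z g f => fmap_comp F f g).

Section Fibration.
Variables (E B : category) (p : functor E B).

(* lies_over f k means p(k) = f; as an inductive family it includes the
   equalities of the endpoints that this equation presupposes. *)
Inductive lies_over :
  forall (a b : B) (f : mor a b) (x y : E) (k : mor x y), Prop :=
  LiesOver x y (k : mor x y) : lies_over (fmap p k) k.

Definition cartesian_lift (a b : B) (f : mor a b) (x y : E) (f' : mor x y) : Prop :=
  lies_over f f' /\
  forall (z : E) (k : mor z y), lies_over f k ->
    exists! u : mor z x, lies_over (idc a) u /\ f' ∘ u = k.

Definition is_fibration : Prop :=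
  (forall (a b : B) (f : mor a b) (y : E), p y = b ->
     exists (x : E) (f' : mor x y), cartesian_lift f f') /\
  (forall (a b c : B) (f : mor a b) (g : mor b c) (x y z : E)
     (f' : mor x y) (g' : mor y z),
     cartesian_lift f f' -> cartesian_lift g g' ->
     cartesian_lift (g ∘ f) (g' ∘ f')).

End Fibration.

Definition is_cofibration (E B : category) (p : functor E B) : Prop :=
  is_fibration (op_functor p).

Record monoidal := Monoidal {
  mcat :> category;
  tob : mcat -> mcat -> mcat;
  thom : forall x x' y y' : mcat, mor x x' -> mor y y' -> mor (tob x y) (tob x' y');
  munit : mcat;
  assoc : forall x y z, mor (tob (tob x y) z) (tob x (tob y z));
  associ : forall x y z, mor (tob x (tob y z)) (tob (tob x y) z);
  lunit : forall x, mor (tob munit x) x;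
  luniti : forall x, mor x (tob munit x);
  runit : forall x, mor (tob x munit) x;
  runiti : forall x, mor x (tob x munit);
  thom1 : forall x y, thom (idc x) (idc y) = idc (tob x y);
  thom_comp : forall x x' x'' y y' y''
    (f' : mor x' x'') (f : mor x x') (g' : mor y' y'') (g : mor y y'),
    thom (f' ∘ f) (g' ∘ g) = thom f' g' ∘ thom f g;
  assocK : forall x y z, associ x y z ∘ assoc x y z = idc _;
  associK : forall x y z, assoc x y z ∘ associ x y z = idc _;
  lunitK : forall x, luniti x ∘ lunit x = idc _;
  lunitiK : forall x, lunit x ∘ luniti x = idc _;
  runitK : forall x, runiti x ∘ runit x = idc _;
  runitiK : forall x, runit x ∘ runiti x = idc _;
  assoc_nat : forall x x' y y' z z' (f : mor x x') (g : mor y y') (h : mor z z'),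
    assoc x' y' z' ∘ thom (thom f g) h = thom f (thom g h) ∘ assoc x y z;
  lunit_nat : forall x x' (f : mor x x'),
    lunit x' ∘ thom (idc munit) f = f ∘ lunit x;
  runit_nat : forall x x' (f : mor x x'),
    runit x' ∘ thom f (idc munit) = f ∘ runit x;
  triangle : forall x y,
    thom (idc x) (lunit y) ∘ assoc x munit y = thom (runit x) (idc y);
  pentagon : forall x y z t,
    assoc x y (tob z t) ∘ assoc (tob x y) z t =
    thom (idc x) (assoc y z t) ∘ assoc x (tob y z) t ∘ thom (assoc x y z) (idc t) }.

Arguments thom {m x x' y y'} f g.
Arguments assoc {m} x y z.
Arguments associ {m} x y z.
Arguments lunit {m} x.
Arguments luniti {m} x.
Arguments runit {m} x.
Arguments runiti {m} x.
Arguments munit {m}.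
Notation "x ⊠ y" := (tob x y) : cat_scope.
Notation "f ⊠h g" := (thom f g) : cat_scope.

Record symmetric_monoidal := SymmetricMonoidal {
  smon :> monoidal;
  braid : forall x y : smon, mor (x ⊠ y) (y ⊠ x);
  braidK : forall x y, braid y x ∘ braid x y = idc _;
  braid_nat : forall x x' y y' (f : mor x x') (g : mor y y'),
    braid x' y' ∘ (f ⊠h g) = (g ⊠h f) ∘ braid x y;
  hexagon : forall x y z,
    assoc y z x ∘ braid x (y ⊠ z) ∘ assoc x y z =
    (idc y ⊠h braid x z) ∘ assoc y x z ∘ (braid x y ⊠h idc z) }.

#[local] Obligation Tactic := idtac.

Section MonoidsAndModules.
Variable V : monoidal.

Record monoid_ob := MonoidOb {
  mon_car :> V;
  mon_mul : mor (mon_car ⊠ mon_car) mon_car;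
  mon_one : mor munit mon_car;
  mon_mulA : mon_mul ∘ (mon_mul ⊠h idc mon_car) =
    mon_mul ∘ (idc mon_car ⊠h mon_mul) ∘ assoc _ _ _;
  mon_mul1l : mon_mul ∘ (mon_one ⊠h idc mon_car) = lunit mon_car;
  mon_mul1r : mon_mul ∘ (idc mon_car ⊠h mon_one) = runit mon_car }.

Record monoid_hom (A B : monoid_ob) := MonoidHom {
  mh_hom :> mor A B;
  mh_mul : mh_hom ∘ mon_mul A = mon_mul B ∘ (mh_hom ⊠h mh_hom);
  mh_one : mh_hom ∘ mon_one A = mon_one B }.

Lemma monoid_hom_eq A B (f g : monoid_hom A B) :
  f = g :> mor A B -> f = g.
Proof.
case: f g => [f f1 f2] [g g1 g2] /= e; subst g.
by rewrite (Prop_irrelevance f1 g1) (Prop_irrelevance f2 g2).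
Qed.

Program Definition monoid_id A : monoid_hom A A := @MonoidHom A A (idc A) _ _.
Next Obligation. by move=> A; rewrite thom1 comp1c compc1. Qed.
Next Obligation. by move=> A; rewrite comp1c. Qed.

Program Definition monoid_comp A B C (g : monoid_hom B C) (f : monoid_hom A B) :
  monoid_hom A C := @MonoidHom A C (g ∘ f) _ _.
Next Obligation.
by move=> A B C g f; rewrite thom_comp -compA mh_mul compA mh_mul compA.
Qed.
Next Obligation. by move=> A B C g f; rewrite -compA !mh_one. Qed.

Program Definition monoids : category :=
  @Category monoid_ob monoid_hom monoid_id monoid_comp _ _ _.
Next Obligation. by move=> A B f; apply/monoid_hom_eq/comp1c. Qed.
Next Obligation. by move=> A B f; apply/monoid_hom_eq/compc1. Qed.
Next Obligation. by move=> A B C D h g f; apply/monoid_hom_eq/compA. Qed.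

Record module_ob (A : monoid_ob) := ModuleOb {
  mod_car :> V;
  mod_act : mor (A ⊠ mod_car) mod_car;
  mod_actA : mod_act ∘ (mon_mul A ⊠h idc mod_car) =
    mod_act ∘ (idc A ⊠h mod_act) ∘ assoc _ _ _;
  mod_act1 : mod_act ∘ (mon_one A ⊠h idc mod_car) = lunit mod_car }.

Record module_hom (A : monoid_ob) (L M : module_ob A) := ModuleHom {
  modh_hom :> mor L M;
  modh_act : modh_hom ∘ mod_act L = mod_act M ∘ (idc A ⊠h modh_hom) }.

Lemma module_hom_eq A (L M : module_ob A) (f g : module_hom L M) :
  f = g :> mor L M -> f = g.
Proof.
case: f g => [f f1] [g g1] /= e; subst g.
by rewrite (Prop_irrelevance f1 g1).
Qed.

(* The module f^*M: A acts on M through f. *)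
Program Definition restrict A B (f : monoid_hom A B) (M : module_ob B) :
  module_ob A := @ModuleOb A M (mod_act M ∘ (f ⊠h idc M)) _ _.
Next Obligation.
move=> A B f M.
rewrite -[LHS]compA -thom_comp mh_mul comp1c.
rewrite -[X in _ ⊠h X](comp1c (idc M)) thom_comp [LHS]compA mod_actA.
rewrite -!compA assoc_nat; congr (_ ∘ _).
by rewrite !compA -!thom_comp !(comp1c, compc1).
Qed.
Next Obligation.
by move=> A B f M; rewrite -compA -thom_comp mh_one comp1c mod_act1.
Qed.

Record rmod := RMod { rmod_base : monoid_ob; rmod_fib : module_ob rmod_base }.

Record rmod_hom (X Y : rmod) := RModHom {
  rh_base : monoid_hom (rmod_base X) (rmod_base Y);
  rh_fib : module_hom (rmod_fib X) (restrict rh_base (rmod_fib Y)) }.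

Lemma rmod_hom_eq X Y (k l : rmod_hom X Y) :
  rh_base k = rh_base l :> mor (rmod_base X) (rmod_base Y) ->
  rh_fib k = rh_fib l :> mor (rmod_fib X) (rmod_fib Y) -> k = l.
Proof.
case: k l => [f a] [g b] /= /monoid_hom_eq e; subst g.
by move=> /(@module_hom_eq _ _ (restrict f _)) ->.
Qed.

Program Definition rmod_id X : rmod_hom X X :=
  @RModHom X X (monoid_id _) (@ModuleHom _ _ (restrict _ _) (idc (rmod_fib X)) _).
Next Obligation. by move=> X /=; rewrite !thom1 comp1c !compc1. Qed.

Program Definition rmod_comp X Y Z (l : rmod_hom Y Z) (k : rmod_hom X Y) :
  rmod_hom X Z :=
  @RModHom X Z (monoid_comp (rh_base l) (rh_base k))
    (@ModuleHom _ _ (restrict _ _)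
      ((rh_fib l : mor (rmod_fib Y) (rmod_fib Z)) ∘ rh_fib k) _).
Next Obligation.
move=> X Y Z [g b] [f a] /=.
have := modh_act b; have := modh_act a => /= ea eb.
rewrite -[LHS]compA ea !compA eb -!compA -!thom_comp; congr (_ ∘ _).
by rewrite !(comp1c, compc1).
Qed.

Program Definition rmods : category :=
  @Category rmod rmod_hom rmod_id rmod_comp _ _ _.
Next Obligation. by move=> X Y k; apply/rmod_hom_eq; apply: comp1c. Qed.
Next Obligation. by move=> X Y k; apply/rmod_hom_eq; apply: compc1. Qed.
Next Obligation. by move=> X Y Z T m l k; apply/rmod_hom_eq; apply: compA. Qed.

Definition rmod_proj : functor rmods monoids :=
  @Functor rmods monoids rmod_base rh_base
    (fun _ => erefl) (fun _ _ _ _ _ => erefl).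

End MonoidsAndModules.

(* The tensor product over R, on which H acts through its comultiplication. *)
Definition htens (R : comPzRingType) (H : hopfAlgebra R) (M N : lmodType H) : Type :=
  tens (res M) (res N).

(* The unit object R, on which H acts through its counit. *)
Definition hunit (R : comPzRingType) (H : hopfAlgebra R) : Type := R.

Section HModObjects.
Variables (R : comPzRingType) (H : hopfAlgebra R).

Section HTens.
Variables M N : lmodType H.

HB.instance Definition _ := GRing.Zmodule.on (htens M N).

Definition htens_scale (h : H) (t : htens M N) : htens M N := tact (comul H h) t.

Lemma htens_scaleA h k t : htens_scale h (htens_scale k t) = htens_scale (h * k) t.
Proof. by rewrite /htens_scale comulM tactA. Qed.
Lemma htens_scale1 : left_id 1 htens_scale.
Proof. by move=> t; rewrite /htens_scale comul1 tact1. Qed.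
Lemma htens_scaleDr : right_distributive htens_scale +%R.
Proof. move=> h s t; exact: (lin_D (@tact_linearr _ _ M N _)). Qed.
Lemma htens_scaleDl t : {morph htens_scale^~ t : h k / h + k}.
Proof.
move=> h k; rewrite /htens_scale.
by rewrite (lin_D (linear_lin (comul H))) (lin_D (tact_linearl t)).
Qed.

HB.instance Definition _ := GRing.Zmodule_isLmodule.Build H (htens M N)
  htens_scaleA htens_scale1 htens_scaleDr htens_scaleDl.

End HTens.

HB.instance Definition _ := GRing.Zmodule.on (hunit H).

Definition hunit_scale (h : H) (r : hunit H) : hunit H := counit H h * (r : R).

Lemma hunit_scaleA h k r : hunit_scale h (hunit_scale k r) = hunit_scale (h * k) r.
Proof. by rewrite /hunit_scale rmorphM mulrA. Qed.
Lemma hunit_scale1 : left_id 1 hunit_scale.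
Proof. by move=> r; rewrite /hunit_scale rmorph1 mul1r. Qed.
Lemma hunit_scaleDr : right_distributive hunit_scale +%R.
Proof. by move=> h r s; rewrite /hunit_scale mulrDr. Qed.
Lemma hunit_scaleDl r : {morph hunit_scale^~ r : h k / h + k}.
Proof. by move=> h k; rewrite /hunit_scale rmorphD mulrDl. Qed.

HB.instance Definition _ := GRing.Zmodule_isLmodule.Build H (hunit H)
  hunit_scaleA hunit_scale1 hunit_scaleDr hunit_scaleDl.

End HModObjects.

Section HMod.
Variables (R : comPzRingType) (H : hopfAlgebra R).
Implicit Types M N P : lmodType H.

Definition hpure M N (m : M) (n : N) : htens M N := (m : res M) ⊗ (n : res N).
Local Notation "m ⊗h n" := (hpure m n) (at level 40, left associativity).

Lemma htens_ind M N (S : htens M N -> Prop) :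
  (forall m n, S (m ⊗h n)) -> (forall s t, S s -> S t -> S (s + t)) ->
  forall t, S t.
Proof. exact: (@tens_ind R (res M) (res N) S). Qed.

Lemma hpureDl M N (n : N) : {morph (fun m : M => m ⊗h n) : x y / x + y}.
Proof. exact: lin_D ((tpure_bilinear (res M) (res N)).1 n). Qed.

Lemma hpureDr M N (m : M) : {morph (fun n : N => m ⊗h n) : x y / x + y}.
Proof. exact: lin_D ((tpure_bilinear (res M) (res N)).2 m). Qed.

Lemma htens_scaleE M N (h : H) (t : htens M N) : h *: t = tact (comul H h) t.
Proof. by []. Qed.

Lemma hunit_scaleE (h : H) (r : hunit H) : h *: r = counit H h * (r : R).
Proof. by []. Qed.

(* The two R-module structures on M (x) N agree. *)
Lemma res_htens M N (a : R) (t : htens M N) :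
  a *: (t : res (htens M N)) = a *: (t : tens (res M) (res N)).
Proof.
rewrite res_scaleE htens_scaleE.
have -> : alg_unit H a = a *: ((1 : H) : res H^o).
  by rewrite res_scaleE -[RHS]/(alg_unit H a * 1) mulr1.
rewrite (lin_Z (linear_lin (comul H))) comul1 (lin_Z (tact_linearl _)).
by rewrite tact1.
Qed.

Lemma res_hunit (a : R) (r : hunit H) : a *: (r : res (hunit H)) = a * (r : R).
Proof. by rewrite res_scaleE hunit_scaleE counit_alg. Qed.

Definition htens_in M N (t : tens (res M) (res N)) : res (htens M N) := t.
Definition htens_out M N (t : res (htens M N)) : tens (res M) (res N) := t.

Lemma htens_in_linear M N : linear (@htens_in M N).
Proof. by move=> a s t; rewrite res_htens. Qed.

Lemma htens_out_linear M N : linear (@htens_out M N).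
Proof. by move=> a s t; rewrite res_htens. Qed.

Lemma hlinear M N (f : M -> N) : {morph f : x y / x + y} ->
  (forall h m, f (h *: m) = h *: f m) -> linear f.
Proof. by move=> fD fZ h x y; rewrite fD fZ. Qed.

Lemma hlinear_can M N (f : M -> N) (g : N -> M) :
  linear f -> cancel f g -> cancel g f -> linear g.
Proof. by move=> lf fK gK a x y; apply: (can_inj fK); rewrite gK lf !gK. Qed.

Lemma htens_ext M N P (f g : {linear htens M N -> P}) :
  (forall m n, f (m ⊗h n) = g (m ⊗h n)) -> f =1 g.
Proof.
by move=> e; elim/htens_ind => [m n|s t es et]; rewrite ?e // !linearD es et.
Qed.

Section Map.
Variables (M M' N N' : lmodType H) (f : {linear M -> M'}) (g : {linear N -> N'}).

Definition hmap : htens M N -> htens M' N' :=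
  tmap (f : res M -> res M') (g : res N -> res N').

Lemma hmap_pure m n : hmap (m ⊗h n) = f m ⊗h g n.
Proof. by rewrite /hmap tmap_pure //; apply/res_linear/linear_lin. Qed.

Lemma hmap_linear : linear hmap.
Proof.
have lm : linear (tmap (f : res M -> res M') (g : res N -> res N')).
  by apply: tmap_linear; apply/res_linear/linear_lin.
have hD : {morph hmap : s t / s + t} by move=> s t; exact: (lin_D lm s t).
apply: (hlinear (f := hmap)) => // h.
elim/htens_ind => [m n|s t es et]; last by rewrite scalerDr !hD scalerDr es et.
rewrite !htens_scaleE hmap_pure.
elim/tens_ind: (comul H h) => [a b|s t es et]; last first.
  by rewrite !(lin_D (tact_linearl _)) -es -et; exact: hD.
by rewrite !tact_pure; rewrite -[LHS]/(hmap (hpure _ _)) hmap_pure !linearZ.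
Qed.

HB.instance Definition _ := GRing.isLinear.Build H (htens M N) (htens M' N') _
  hmap hmap_linear.

End Map.

Section Assoc.
Variables M N P : lmodType H.

Definition hassoc (t : htens (htens M N) P) : htens M (htens N P) :=
  tmap (@idfun (res M)) (@htens_in N P)
    (tassoc (tmap (@htens_out M N) (@idfun (res P)) t)).

Definition hassoc_inv (t : htens M (htens N P)) : htens (htens M N) P :=
  tmap (@htens_in M N) (@idfun (res P))
    (tassoc_inv (tmap (@idfun (res M)) (@htens_out N P) t)).

Lemma idfun_linear (U : lmodType R) : linear (@idfun U).
Proof. by []. Qed.

Lemma hassoc_pure m n p : hassoc ((m ⊗h n) ⊗h p) = m ⊗h (n ⊗h p).
Proof.
rewrite /hassoc [X in tassoc X](tmap_pure _ _ (@htens_out_linear M N) (@idfun_linear (res P))).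
rewrite tassoc_pure.
exact: (tmap_pure _ _ (@idfun_linear (res M)) (@htens_in_linear N P)).
Qed.

Lemma hassoc_inv_pure m n p : hassoc_inv (m ⊗h (n ⊗h p)) = (m ⊗h n) ⊗h p.
Proof.
rewrite /hassoc_inv
  [X in tassoc_inv X](tmap_pure _ _ (@idfun_linear (res M)) (@htens_out_linear N P)).
rewrite tassoc_inv_pure.
exact: (tmap_pure _ _ (@htens_in_linear M N) (@idfun_linear (res P))).
Qed.

Lemma hassocD : {morph hassoc : x y / x + y}.
Proof.
move=> x y; rewrite /hassoc.
rewrite (lin_D (tmap_linear (@htens_out_linear M N) (@idfun_linear (res P)))).
rewrite (lin_D (@tassoc_linear _ _ _ _)).
by rewrite (lin_D (tmap_linear (@idfun_linear (res M)) (@htens_in_linear N P))).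
Qed.

Lemma hassoc_invD : {morph hassoc_inv : x y / x + y}.
Proof.
move=> x y; rewrite /hassoc_inv.
rewrite (lin_D (tmap_linear (@idfun_linear (res M)) (@htens_out_linear N P))).
rewrite (lin_D (@tassoc_inv_linear _ _ _ _)).
by rewrite (lin_D (tmap_linear (@htens_in_linear M N) (@idfun_linear (res P)))).
Qed.

Lemma hassocK : cancel hassoc hassoc_inv.
Proof.
elim/htens_ind => [t p|s t es et]; last by rewrite hassocD hassoc_invD es et.
elim/htens_ind: t => [m n|s t es et]; last by rewrite hpureDl hassocD hassoc_invD es et.
by rewrite hassoc_pure hassoc_inv_pure.
Qed.

Lemma hassoc_invK : cancel hassoc_inv hassoc.
Proof.
elim/htens_ind => [m t|s t es et]; last by rewrite hassoc_invD hassocD es et.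
elim/htens_ind: t => [n p|s t es et]; last by rewrite hpureDr hassoc_invD hassocD es et.
by rewrite hassoc_inv_pure hassoc_pure.
Qed.

Section AssocLinear.
Variables (m : M) (n : N) (p : P).
Local Notation Hr := (res H^o).

Let T3 : tens Hr (HH H) -> res (htens M (htens N P)) :=
  tlift (fun (a : Hr) (y : HH H) =>
    htens_in (((a : H) *: m : res M) ⊗
              (htens_in (tact y ((n : res N) ⊗ (p : res P)))))).

Let T3_bil : bilinear_map (fun (a : Hr) (y : HH H) =>
    htens_in (((a : H) *: m : res M) ⊗
              (htens_in (tact y ((n : res N) ⊗ (p : res P)))))).
Proof.
apply: linear_bilinear (@htens_in_linear _ _).
apply: (bilinear_comp (tpure_bilinear (res M) (res (htens N P)))
  (f := fun a : Hr => (a : H) *: m : res M)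
  (g := fun y => htens_in (tact y ((n : res N) ⊗ (p : res P))))).
  exact: act_linearl.
exact: (linear_comp (tact_linearl _) (@htens_in_linear N P)).
Qed.

Let T3_lin : linear T3 := tlift_linear T3_bil.

Let T3_pure (a : Hr) (y : HH H) : T3 (a ⊗ y) =
  htens_in (((a : H) *: m : res M) ⊗ (htens_in (tact y ((n : res N) ⊗ (p : res P))))).
Proof. exact: tlift_pure T3_bil. Qed.

Lemma hassoc_actl (s : HH H) :
  hassoc (tact s ((((m ⊗h n) : res (htens M N))) ⊗ (p : res P))) =
  T3 (tassoc (tmap (comul H) (@idfun Hr) s)).
Proof.
have lc := linear_lin (comul H).
have lt := tmap_linear lc (@idfun_linear Hr).
elim/tens_ind: s => [a b|s t es et]; last first.
  rewrite (lin_D (tact_linearl _)) (lin_D lt) (lin_D (@tassoc_linear _ _ _ _)).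
  by rewrite (lin_D T3_lin) -es -et; exact: hassocD.
rewrite (tmap_pure _ _ lc (@idfun_linear Hr)) tact_pure htens_scaleE /idfun.
pose F (v : htens M N) := hassoc (v ⊗h ((b : H) *: (p : P) : P)).
have FD : {morph F : x y / x + y} by move=> x y; rewrite /F hpureDl hassocD.
elim/tens_ind: (comul H a) => [c d|s t es et]; last first.
  rewrite (lin_D (tact_linearl _)) [in RHS](lin_D ((tpure_bilinear _ _).1 _)).
  by rewrite (lin_D (@tassoc_linear _ _ _ _)) (lin_D T3_lin) -es -et; exact: FD.
rewrite tact_pure tassoc_pure T3_pure tact_pure.
exact: hassoc_pure.
Qed.

Lemma hassoc_actr (s : HH H) :
  tact s ((m : res M) ⊗ ((n ⊗h p) : res (htens N P))) =
  T3 (tmap (@idfun Hr) (comul H) s).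
Proof.
have lc := linear_lin (comul H).
have lt := tmap_linear (@idfun_linear Hr) lc.
elim/tens_ind: s => [a b|s t es et]; last first.
  by rewrite (lin_D (tact_linearl _)) (lin_D lt) (lin_D T3_lin) -es -et.
rewrite (tmap_pure _ _ (@idfun_linear Hr) lc) tact_pure htens_scaleE /idfun.
by rewrite T3_pure.
Qed.

End AssocLinear.

Lemma hassoc_linear : linear hassoc.
Proof.
apply: (hlinear (f := hassoc)) => [|h]; first exact: hassocD.
elim/htens_ind => [t p|s t es et]; last by rewrite scalerDr !hassocD scalerDr es et.
elim/htens_ind: t => [m n|s t es et].
  rewrite hassoc_pure (htens_scaleE h (_ ⊗h _)) htens_scaleE.
  by rewrite [RHS]hassoc_actr -comulA -hassoc_actl.
by rewrite hpureDl scalerDr !hassocD scalerDr es et.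
Qed.

Lemma hassoc_inv_linear : linear hassoc_inv.
Proof. exact: hlinear_can hassoc_linear hassocK hassoc_invK. Qed.

HB.instance Definition _ := GRing.isLinear.Build H (htens (htens M N) P)
  (htens M (htens N P)) _ hassoc hassoc_linear.
HB.instance Definition _ := GRing.isLinear.Build H (htens M (htens N P))
  (htens (htens M N) P) _ hassoc_inv hassoc_inv_linear.

End Assoc.

Section Unit.
Variable M : lmodType H.

Definition hlunit (t : htens (hunit H) M) : M :=
  tlift (fun (r : res (hunit H)) (m : res M) => (r : R) *: m) t.
Definition hlunit_inv (m : M) : htens (hunit H) M := ((1 : R) : hunit H) ⊗h m.
Definition hrunit (t : htens M (hunit H)) : M :=
  tlift (fun (m : res M) (r : res (hunit H)) => (r : R) *: m) t.
Definition hrunit_inv (m : M) : htens M (hunit H) := m ⊗h ((1 : R) : hunit H).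

Lemma hlunit_bil :
  bilinear_map (fun (r : res (hunit H)) (m : res M) => (r : R) *: m).
Proof.
split=> [m|r] a u v /=; last by rewrite scalerDr !scalerA mulrC.
by rewrite res_hunit [LHS]scalerDl scalerA.
Qed.

Lemma hlunit_pure r m : hlunit (r ⊗h m) = (r : R) *: (m : res M).
Proof. by rewrite /hlunit (tlift_pure _ _ hlunit_bil). Qed.

Lemma hrunit_pure m r : hrunit (m ⊗h r) = (r : R) *: (m : res M).
Proof. by rewrite /hrunit (tlift_pure _ _ (bilinear_swap hlunit_bil)). Qed.

Lemma hlunitD : {morph hlunit : x y / x + y}.
Proof. exact: lin_D (tlift_linear hlunit_bil). Qed.

Lemma hrunitD : {morph hrunit : x y / x + y}.
Proof. exact: lin_D (tlift_linear (bilinear_swap hlunit_bil)). Qed.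

Let counit_bil : bilinear_map (fun a b : res H^o => counit H a *: b).
Proof.
split=> [b|a] k u v /=; last by rewrite scalerDr !scalerA mulrC.
rewrite rmorphD [LHS]scalerDl scalerA; congr (_ *: _ + _).
by rewrite res_scaleE -[alg_unit H k *: _]/(alg_unit H k * _) rmorphM counit_alg.
Qed.

Lemma hlunit_linear : linear hlunit.
Proof.
apply: (hlinear (f := hlunit)) => [|h]; first exact: hlunitD.
elim/htens_ind => [r m|s t es et]; last by rewrite scalerDr !hlunitD scalerDr es et.
rewrite hlunit_pure htens_scaleE -{2}(counitl h).
elim/tens_ind: (comul H h) => [a b|s t es et]; last first.
  rewrite (lin_D (tact_linearl _)) (lin_D (tlift_linear counit_bil)).
  by rewrite scalerDl -es -et; exact: hlunitD.
rewrite tact_pure (tlift_pure _ _ counit_bil) [LHS]hlunit_pure hunit_scaleE.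
rewrite -[counit H a *: b]/(alg_unit H (counit H a) * (b : H)).
rewrite !res_scaleE !scalerA rmorphM -!mulrA; congr (_ * _ *: _).
by rewrite alg_central.
Qed.

Lemma hrunit_linear : linear hrunit.
Proof.
apply: (hlinear (f := hrunit)) => [|h]; first exact: hrunitD.
elim/htens_ind => [m r|s t es et]; last by rewrite scalerDr !hrunitD scalerDr es et.
rewrite hrunit_pure htens_scaleE -{2}(counitr h).
elim/tens_ind: (comul H h) => [a b|s t es et]; last first.
  rewrite (lin_D (tact_linearl _)) (lin_D (tlift_linear (bilinear_swap counit_bil))).
  by rewrite scalerDl -es -et; exact: hrunitD.
rewrite tact_pure (tlift_pure _ _ (bilinear_swap counit_bil)) [LHS]hrunit_pure.
rewrite hunit_scaleE -[counit H b *: a]/(alg_unit H (counit H b) * (a : H)).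
rewrite !res_scaleE !scalerA rmorphM -!mulrA.
by congr (_ * _ *: _); rewrite alg_central.
Qed.

Lemma hlunitK : cancel hlunit hlunit_inv.
Proof.
elim/htens_ind => [r m|s t es et]; last by rewrite hlunitD /hlunit_inv hpureDr -{2}es -{2}et.
rewrite hlunit_pure /hlunit_inv /hpure (lin_Z ((tpure_bilinear _ _).2 _)).
by rewrite -(lin_Z ((tpure_bilinear _ _).1 _)) res_hunit mulr1.
Qed.

Lemma hlunit_invK : cancel hlunit_inv hlunit.
Proof. by move=> m; rewrite hlunit_pure scale1r. Qed.

Lemma hrunitK : cancel hrunit hrunit_inv.
Proof.
elim/htens_ind => [m r|s t es et]; last by rewrite hrunitD /hrunit_inv hpureDl -{2}es -{2}et.
rewrite hrunit_pure /hrunit_inv /hpure (lin_Z ((tpure_bilinear _ _).1 _)).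
by rewrite -(lin_Z ((tpure_bilinear _ _).2 _)) res_hunit mulr1.
Qed.

Lemma hrunit_invK : cancel hrunit_inv hrunit.
Proof. by move=> m; rewrite hrunit_pure scale1r. Qed.

Lemma hlunit_inv_linear : linear hlunit_inv.
Proof. exact: hlinear_can hlunit_linear hlunitK hlunit_invK. Qed.

Lemma hrunit_inv_linear : linear hrunit_inv.
Proof. exact: hlinear_can hrunit_linear hrunitK hrunit_invK. Qed.

HB.instance Definition _ :=
  GRing.isLinear.Build H (htens (hunit H) M) M _ hlunit hlunit_linear.
HB.instance Definition _ :=
  GRing.isLinear.Build H M (htens (hunit H) M) _ hlunit_inv hlunit_inv_linear.
HB.instance Definition _ :=
  GRing.isLinear.Build H (htens M (hunit H)) M _ hrunit hrunit_linear.
HB.instance Definition _ :=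
  GRing.isLinear.Build H M (htens M (hunit H)) _ hrunit_inv hrunit_inv_linear.

End Unit.

Definition hswap M N (t : htens M N) : htens N M :=
  @tswap R (res M) (res N) t.

Lemma hswap_pure M N (m : M) (n : N) : hswap (m ⊗h n) = n ⊗h m.
Proof. exact: tswap_pure. Qed.

Lemma hswapD M N : {morph @hswap M N : x y / x + y}.
Proof. exact: lin_D (@tswap_linear R (res M) (res N)). Qed.

Lemma hswap_linear M N : cocommutative H -> linear (@hswap M N).
Proof.
move=> cH; apply: (hlinear (f := @hswap M N)) => [|h]; first exact: hswapD.
elim/htens_ind => [m n|s t es et]; last by rewrite scalerDr !hswapD scalerDr es et.
rewrite hswap_pure !htens_scaleE -{2}(cH h).
elim/tens_ind: (comul H h) => [a b|s t es et]; last first.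
  rewrite (lin_D (tact_linearl _)) (lin_D (@tswap_linear _ _ _)).
  by rewrite (lin_D (tact_linearl _)) -es -et; exact: hswapD.
by rewrite tact_pure tswap_pure tact_pure; exact: hswap_pure.
Qed.

End HMod.

Section HModCategory.
Variables (R : comPzRingType) (H : hopfAlgebra R).
Implicit Types M N P Q S : lmodType H.

#[local] Obligation Tactic := idtac.

Program Definition hmod_cat : category :=
  @Category (lmodType H) (fun M N => {linear M -> N})
    (fun M => @idfun M : {linear M -> M}) (fun M N P g f => g \o f : {linear M -> P}) _ _ _.
Next Obligation. by move=> M N f; apply: lin_eq. Qed.
Next Obligation. by move=> M N f; apply: lin_eq. Qed.
Next Obligation. by move=> M N P Q h g f; apply: lin_eq. Qed.

Lemma hext3l M N P Q (f g : {linear htens (htens M N) P -> Q}) :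
  (forall m n p, f (hpure (hpure m n) p) = g (hpure (hpure m n) p)) -> f =1 g.
Proof.
move=> e; apply: htens_ext => t p; elim/htens_ind: t => [m n|s t es et] //.
by rewrite !hpureDl !linearD es et.
Qed.

Lemma hext3r M N P Q (f g : {linear htens M (htens N P) -> Q}) :
  (forall m n p, f (hpure m (hpure n p)) = g (hpure m (hpure n p))) -> f =1 g.
Proof.
move=> e; apply: htens_ext => m t; elim/htens_ind: t => [n p|s t es et] //.
by rewrite !hpureDr !linearD es et.
Qed.

Lemma hext4l M N P Q S (f g : {linear htens (htens (htens M N) P) Q -> S}) :
  (forall m n p q, f (hpure (hpure (hpure m n) p) q) =
                   g (hpure (hpure (hpure m n) p) q)) -> f =1 g.
Proof.
move=> e; apply: hext3l => t p q; elim/htens_ind: t => [m n|s t es et] //.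
by rewrite !hpureDl !linearD es et.
Qed.

Program Definition hmod_monoidal : monoidal :=
  @Monoidal hmod_cat (fun M N : lmodType H => htens M N : lmodType H)
    (fun (M M' N N' : lmodType H) (f : {linear M -> M'}) (g : {linear N -> N'}) =>
       hmap f g : {linear htens M N -> htens M' N'})
    (hunit H : lmodType H)
    (fun M N P : lmodType H =>
       @hassoc R H M N P : {linear htens (htens M N) P -> htens M (htens N P)})
    (fun M N P : lmodType H =>
       @hassoc_inv R H M N P : {linear htens M (htens N P) -> htens (htens M N) P})
    (fun M : lmodType H => @hlunit R H M : {linear htens (hunit H) M -> M})
    (fun M : lmodType H => @hlunit_inv R H M : {linear M -> htens (hunit H) M})
    (fun M : lmodType H => @hrunit R H M : {linear htens M (hunit H) -> M})
    (fun M : lmodType H => @hrunit_inv R H M : {linear M -> htens M (hunit H)})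
    _ _ _ _ _ _ _ _ _ _ _ _ _.
Next Obligation.
by move=> M N; apply/lin_eq/htens_ext => m n /=; rewrite hmap_pure.
Qed.
Next Obligation.
move=> M M' M'' N N' N'' f' f g' g; apply/lin_eq/htens_ext => m n /=.
by rewrite !hmap_pure.
Qed.
Next Obligation. by move=> M N P; apply/lin_eq => t; apply: hassocK. Qed.
Next Obligation. by move=> M N P; apply/lin_eq => t; apply: hassoc_invK. Qed.
Next Obligation. by move=> M; apply/lin_eq => t; apply: hlunitK. Qed.
Next Obligation. by move=> M; apply/lin_eq => t; apply: hlunit_invK. Qed.
Next Obligation. by move=> M; apply/lin_eq => t; apply: hrunitK. Qed.
Next Obligation. by move=> M; apply/lin_eq => t; apply: hrunit_invK. Qed.
Next Obligation.
move=> M M' N N' P P' f g h; apply/lin_eq/hext3l => m n p /=.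
by rewrite hassoc_pure !hmap_pure /= !hmap_pure hassoc_pure.
Qed.
Next Obligation.
move=> M M' f; apply/lin_eq/htens_ext => r m /=.
rewrite hmap_pure !hlunit_pure /=.
by rewrite (lin_Z (res_linear (linear_lin f))).
Qed.
Next Obligation.
move=> M M' f; apply/lin_eq/htens_ext => m r /=.
rewrite hmap_pure !hrunit_pure /=.
by rewrite (lin_Z (res_linear (linear_lin f))).
Qed.
Next Obligation.
move=> M N; apply/lin_eq/hext3l => m r n /=.
rewrite hassoc_pure !hmap_pure /= hlunit_pure hrunit_pure /hpure.
by rewrite (lin_Z ((tpure_bilinear _ _).1 _)) (lin_Z ((tpure_bilinear _ _).2 _)).
Qed.
Next Obligation.
move=> M N P Q; apply/lin_eq/hext4l => m n p q /=.
by rewrite !(hassoc_pure, hmap_pure) /= !(hassoc_pure, hmap_pure) /= hassoc_pure.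
Qed.

Section Swap.
Variables (cH : cocommutative H) (M N : lmodType H).
HB.instance Definition _ := GRing.isLinear.Build H (htens M N) (htens N M) _
  (@hswap R H M N) (hswap_linear cH).
Definition hbraid : {linear htens M N -> htens N M} := @hswap R H M N.
End Swap.

Program Definition HMod (cH : cocommutative H) : symmetric_monoidal :=
  @SymmetricMonoidal hmod_monoidal (fun M N => hbraid cH M N) _ _ _.
Next Obligation.
move=> cH M N; apply/lin_eq/htens_ext => m n /=; by rewrite !hswap_pure.
Qed.
Next Obligation.
move=> cH M M' N N' f g; apply/lin_eq/htens_ext => m n /=.
by rewrite hmap_pure !hswap_pure hmap_pure.
Qed.
Next Obligation.
move=> cH M N P; apply/lin_eq/hext3l => m n p /=.
by do ?[rewrite (hassoc_pure, hswap_pure, hmap_pure) /=].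
Qed.

End HModCategory.

(* Main.v *)
(* For f : A -> B, restriction f^*N, with the identity of N as underlying map, is
   a cartesian lift in the strong sense: it also factors morphisms lying over a
   composite f h. Strong lifts make both kinds of lifts closed under composition:
   every cartesian lift is isomorphic to a strong one, and factoring through a
   strong lift reduces the universal property of a composite of cocartesian
   lifts to those of its factors. The cocartesian lift of f at M is extension of
   scalars B (x)_A M, the cokernel in H-Mod of the map
   B (x) (A (x) M) -> B (x) M,  b (x) (a (x) m) |-> b (x) a m - b f(a) (x) m;
   it inherits a B-action because B (x) - preserves cokernels. *)
Require Import Defs.
From HB Require Import structures.
From mathcomp Require Import all_boot all_algebra.
From mathcomp Require Import boolp.

Set Implicit Arguments.
Unset Strict Implicit.
Unset Printing Implicit Defensive.

Import Defs GRing.Theory.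
Local Open Scope quotient_scope.
Local Open Scope ring_scope.
Local Open Scope cat_scope.

(** * Calculus of morphisms lying over a given base morphism *)

Section LiesOver.
Variables (E B : category) (p : functor E B).

Lemma lies_over_dom (a b : B) (f : mor a b) (x y : E) (k : mor x y) :
  lies_over p f k -> p x = a.
Proof. by case. Qed.

Lemma lies_over_cod (a b : B) (f : mor a b) (x y : E) (k : mor x y) :
  lies_over p f k -> p y = b.
Proof. by case. Qed.

Lemma lies_overE (x y : E) (f : mor (p x) (p y)) (k : mor x y) :
  lies_over p f k -> fmap p k = f.
Proof.
(* Inverting [lies_over] requires free endpoints [a] and [b], so the equation is first stated with
   transports along [ea] and [eb]; proof irrelevance turns both into [erefl]. *)
have gen (a b : B) (g : mor a b) (l : mor x y) : lies_over p g l ->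
    forall (ea : a = p x) (eb : b = p y),
      fmap p l = eq_rect b (mor (p x)) (eq_rect a (fun c => mor c b) g _ ea) _ eb.
  case=> x' y' {}l ea eb.
  by rewrite (Prop_irrelevance ea erefl) (Prop_irrelevance eb erefl).
by move=> /gen /(_ erefl erefl).
Qed.

Lemma lies_over_id (x : E) : lies_over p (idc (p x)) (idc x).
Proof. by rewrite -fmap1; constructor. Qed.

Lemma lies_over_comp (a b c : B) (g : mor b c) (f : mor a b)
    (x y z : E) (l : mor y z) (k : mor x y) :
  lies_over p g l -> lies_over p f k -> lies_over p (g ∘ f) (l ∘ k).
Proof.
move=> ol ok; move: (lies_over_cod ol) (lies_over_cod ok) (lies_over_dom ok).
move=> ec eb ea; subst; rewrite -(lies_overE ol) -(lies_overE ok) -fmap_comp.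
exact: LiesOver.
Qed.

(** Over the opposite functor [lies_over] is a different instance of the inductive family, so the
    two are related by an equivalence and not by conversion. *)
Lemma lies_over_op (a b : B) (f : mor a b) (x y : E) (k : mor x y) :
  @lies_over (op_cat E) (op_cat B) (op_functor p) b a f y x k <-> lies_over p f k.
Proof.
split; last by case=> {}x {}y {}k; exact: (@LiesOver _ _ (op_functor p) y x k).
by case=> {}y {}x {}k; exact: LiesOver.
Qed.

End LiesOver.

(** * Strong lifts, and closure of both kinds of lifts under composition *)

Section StrongLifts.
Variables (E B : category) (p : functor E B).

(* Unlike [cartesian_lift], this tests against morphisms over any [f ∘ h]. *)
Definition strong_lift (a b : B) (f : mor a b) (x y : E) (s : mor x y) : Prop :=
  lies_over p f s /\
  forall (c : B) (h : mor c a) (z : E) (k : mor z y), lies_over p (f ∘ h) k ->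
    exists! u : mor z x, lies_over p h u /\ s ∘ u = k.

Definition has_strong_lifts : Prop :=
  forall (a b : B) (f : mor a b) (y : E), p y = b ->
    exists (x : E) (s : mor x y), strong_lift f s.

Lemma strong_lift_cartesian (a b : B) (f : mor a b) (x y : E) (s : mor x y) :
  strong_lift f s -> cartesian_lift p f s.
Proof.
by case=> os us; split=> // z k; rewrite -{1}[f]compc1 => /us.
Qed.

Hypothesis strong : has_strong_lifts.

(** The strong lift [s] of [f] and the lift [f'] factor through each other by vertical maps:
    [f' ∘ v = s] and [s ∘ u = f']. A factorisation through [s] is carried to one through [f'] by
    [v], and [v ∘ u = idc x] transfers uniqueness back. *)
Lemma cartesian_lift_strong (a b : B) (f : mor a b) (x y : E) (f' : mor x y) :
  cartesian_lift p f f' -> strong_lift f f'.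
Proof.
case=> of' uf'; have [x0 [s [os us]]] := strong f (lies_over_cod of').
have [v [[ov vE] _]] := uf' _ _ os.
have [|u [[ou uE] _]] := us _ (idc a) _ f'; first by rewrite compc1.
have ea := lies_over_dom of'; subst a.
have vuK : v ∘ u = idc x.
  (* Both [v ∘ u] and the identity factor [f'] through itself, so uniqueness for [f'] identifies
     them. *)
  have [w [_ wE]] := uf' _ _ of'; rewrite -(wE (v ∘ u)) ?(wE (idc x)) //.
    by rewrite compc1; split=> //; exact: lies_over_id.
  by rewrite compA vE uE -{1}[idc (p x)]comp1c; split=> //; exact: lies_over_comp.
split=> // c h z k ok; have [w [[ow wE] w_uniq]] := us _ _ _ _ ok.
exists (v ∘ w); split=> [|w' [ow' w'E]].
  by rewrite compA vE -[h]comp1c; split=> //; exact: lies_over_comp.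
rewrite (w_uniq (u ∘ w')) ?compA ?vuK ?comp1c //.
by rewrite uE -[h]comp1c; split=> //; exact: lies_over_comp.
Qed.

(** For a composite, [k] over [g ∘ f] factors first through [g'], which is strong, by some [k1] over
    [f]; then [k1] factors through the cartesian lift [f']. *)
Lemma strong_lifts_fibration : is_fibration p.
Proof.
split=> [a b f y /(strong f)[x [s ls]]|a b c f g x y z f' g' [of' uf']].
  by exists x, s; exact: strong_lift_cartesian.
move=> /cartesian_lift_strong[og ug]; split=> [|w k ok]; first exact: lies_over_comp.
have [k1 [[ok1 k1E] k1_uniq]] := ug _ _ _ _ ok.
have [u [[ou uE] u_uniq]] := uf' _ _ ok1.
exists u; split=> [|u' [ou' u'E]]; first by rewrite -compA uE.
apply: u_uniq; split=> //; rewrite (k1_uniq (f' ∘ u')) // compA; split=> //.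
by rewrite -[f]compc1; exact: lies_over_comp.
Qed.

Definition cocartesian_lift (a b : B) (f : mor a b) (x y : E) (f' : mor x y) : Prop :=
  lies_over p f f' /\
  forall (z : E) (k : mor x z), lies_over p f k ->
    exists! u : mor y z, lies_over p (idc b) u /\ u ∘ f' = k.

Lemma cartesian_lift_op (a b : B) (f : mor a b) (x y : E) (f' : mor x y) :
  @cartesian_lift (op_cat E) (op_cat B) (op_functor p) b a f y x f' <->
  cocartesian_lift f f'.
Proof.
split=> -[/lies_over_op of' uf']; split=> // z k /lies_over_op /uf'.
  by case=> u [[/lies_over_op ou uE] uu]; exists u; split=> // v [/lies_over_op]; auto.
by case=> u [[/lies_over_op ou uE] uu]; exists u; split=> // v [/lies_over_op]; auto.
Qed.

(** The property of [f'] concerns only morphisms over [f], while [k] lies over [g ∘ f]. The strong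
    lift [s] of [g] into the target of [k] bridges the gap: [k = s ∘ k1] with [k1] over [f], then
    [k1 = u1 ∘ f'], and [s ∘ u1] over [g] factors through [g']. *)
Lemma cocartesian_lift_comp (a b c : B) (f : mor a b) (g : mor b c)
    (x y z : E) (f' : mor x y) (g' : mor y z) :
  cocartesian_lift f f' -> cocartesian_lift g g' ->
  cocartesian_lift (g ∘ f) (g' ∘ f').
Proof.
move=> [of' uf'] [og ug]; split=> [|w k ok]; first exact: lies_over_comp.
have [w0 [s [os us]]] := strong g (lies_over_cod ok).
have [k1 [[ok1 k1E] k1_uniq]] := us _ _ _ _ ok.
have [u1 [[ou1 u1E] u1_uniq]] := uf' _ _ ok1.
have osu : lies_over p g (s ∘ u1) by rewrite -[g]compc1; exact: lies_over_comp.
have [u [[ou uE] u_uniq]] := ug _ _ osu.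
exists u; split=> [|u' [ou' u'E]]; first by rewrite compA uE -compA u1E.
apply: u_uniq; split=> //.
(* For uniqueness, [u' ∘ g'] is also factored through [s], by a vertical [v]; both [v ∘ f'] and [k1]
   factor [k] through [s], which forces [v = u1]. *)
have [|v [[ov vE] _]] := us _ (idc b) _ (u' ∘ g').
  by rewrite compc1 -[g]comp1c; exact: lies_over_comp.
rewrite -vE (u1_uniq v) //; split=> //; rewrite (k1_uniq (v ∘ f')) //.
rewrite compA vE -compA; split=> //.
by rewrite -[f]comp1c; exact: lies_over_comp.
Qed.

Lemma strong_lifts_cofibration :
  (forall (a b : B) (f : mor a b) (x : E), p x = a ->
     exists (y : E) (f' : mor x y), cocartesian_lift f f') ->
  is_cofibration p.
Proof.
move=> colift; split=> [b a f x /(colift _ _ f)[y [f' lf]]|].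
  by exists y, f'; apply/cartesian_lift_op.
move=> c b a g f z y x g' f' /cartesian_lift_op lg /cartesian_lift_op lf.
exact/cartesian_lift_op/cocartesian_lift_comp.
Qed.

End StrongLifts.

(** * Lifts for modules over monoids in an arbitrary monoidal category *)

Section Modules.
Variable V : monoidal.

Definition rmod_mor (A B : monoid_ob V) (L : module_ob A) (M : module_ob B)
    (f : monoid_hom A B) (a : module_hom L (restrict f M)) :
    @mor (rmods V) (RMod L) (RMod M) :=
  @RModHom V (RMod L) (RMod M) f a.

Lemma lies_over_rmod (A B : monoid_ob V) (L : module_ob A) (M : module_ob B)
    (f : monoid_hom A B) (a : module_hom L (restrict f M)) :
  @lies_over _ _ (rmod_proj V) A B f (RMod L) (RMod M) (rmod_mor a).
Proof. exact: (@LiesOver _ _ (rmod_proj V) _ _ (rmod_mor a)). Qed.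

(** The type of the fibre component depends on the base component, so the base is made literally [f]
    before fibre components are compared. *)
Lemma lies_over_rmodE (A B : monoid_ob V) (L : module_ob A) (M : module_ob B)
    (f : monoid_hom A B) (k : @mor (rmods V) (RMod L) (RMod M)) :
  @lies_over _ _ (rmod_proj V) A B f (RMod L) (RMod M) k ->
  exists a : module_hom L (restrict f M), k = rmod_mor a.
Proof.
move=> /(@lies_overE _ _ (rmod_proj V) (RMod L) (RMod M)) /= kE.
by case: k kE => g a /= gE; subst g; exists a.
Qed.

Lemma rmod_strong_lifts : has_strong_lifts (rmod_proj V).
Proof.
move=> A B f [B' N] /= eB; subst B'.
have act_id : idc N ∘ mod_act (restrict f N) =
    mod_act (restrict f N) ∘ (idc _ ⊠h idc N).
  by rewrite /= thom1 comp1c compc1.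
exists (RMod (restrict f N)), (rmod_mor (ModuleHom (M := restrict f N) act_id)).
split=> [|C h [C' L] k ok]; first exact: lies_over_rmod.
have /= eC := lies_over_dom ok; subst C'.
have [a {ok}->] := lies_over_rmodE ok.
(* Restriction along [f ∘ h] and iterated restriction give the same action only up to functoriality
   of the tensor product, so [a] has to be equipped with a new proof of equivariance. *)
have act_a : (a : mor L N) ∘ mod_act L =
    mod_act (restrict h (restrict f N)) ∘ (idc _ ⊠h (a : mor L N)).
  rewrite (modh_act a) /=; congr (_ ∘ _).
  by rewrite -[RHS]compA -thom_comp comp1c.
exists (rmod_mor (ModuleHom (M := restrict h (restrict f N)) act_a)); split.
  split; first exact: lies_over_rmod.
  by apply: rmod_hom_eq => //=; exact: comp1c.
move=> u [/lies_over_rmodE [b ->]].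
move=> /(congr1 (fun w : rmod_hom (RMod L) (RMod N) => rh_fib w : mor L N)) /= bE.
by apply: rmod_hom_eq => //=; rewrite -bE comp1c.
Qed.

(** A universal arrow from [M] to restriction along [f], the unit of extension of scalars, is
    exactly the fibre part of a cocartesian lift: vertical morphisms out of [N] are module morphisms
    over [B]. *)
Lemma rmod_cocartesian_lifts :
  (forall (A B : monoid_ob V) (f : monoid_hom A B) (M : module_ob A),
     exists (N : module_ob B) (e : module_hom M (restrict f N)),
       forall (P : module_ob B) (g : module_hom M (restrict f P)),
         exists! u : module_hom N P, (u : mor N P) ∘ (e : mor M N) = g) ->
  forall (A B : monoids V) (f : mor A B) (X : rmods V), rmod_proj V X = A ->
    exists (Y : rmods V) (f' : mor X Y), cocartesian_lift (rmod_proj V) f f'.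
Proof.
move=> ext A B f [A' M] /= eA; subst A'; have [N [e e_univ]] := ext _ _ f M.
exists (RMod N), (rmod_mor e); split=> [|[B' P] k ok]; first exact: lies_over_rmod.
have /= eB := lies_over_cod ok; subst B'.
have [a {ok}->] := lies_over_rmodE ok.
(* A vertical morphism formally lands in the restriction of [P] along the identity; this equation
   passes between that module and [P]. *)
have restrict_id : mod_act (restrict (monoid_id B) P) = mod_act P.
  by rewrite /= thom1 compc1.
have [u [uE u_uniq]] := e_univ _ a.
have act_u : (u : mor N P) ∘ mod_act N =
    mod_act (restrict (monoid_id B) P) ∘ (idc _ ⊠h (u : mor N P)).
  by rewrite restrict_id; exact: modh_act u.
exists (rmod_mor (ModuleHom (M := restrict (monoid_id B) P) act_u)); split.
  split; first exact: lies_over_rmod.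
  by apply: rmod_hom_eq => //=; exact: comp1c.
move=> v' [/lies_over_rmodE [v ->]].
move=> /(congr1 (fun w : rmod_hom (RMod M) (RMod P) => rh_fib w : mor M P)) /= vE.
have act_v : (v : mor N P) ∘ mod_act N = mod_act P ∘ (idc _ ⊠h (v : mor N P)).
  by rewrite -restrict_id; exact: modh_act v.
by apply: rmod_hom_eq => //=; rewrite (u_uniq (ModuleHom act_v)).
Qed.

End Modules.

(** * Cokernels of linear maps *)

Section Cokernel.
Variables (S : pzRingType) (X Y : lmodType S) (d : {linear X -> Y}).

Definition coker_eq : rel Y := fun y z => `[< exists x, y - z = d x >].

Lemma coker_eq_refl : reflexive coker_eq.
Proof. by move=> y; apply/asboolP; exists 0; rewrite subrr linear0. Qed.

Lemma coker_eq_sym : symmetric coker_eq.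
Proof.
have sub y z : coker_eq y z -> coker_eq z y.
  move=> /asboolP[x e]; apply/asboolP; exists (- x).
  by rewrite linearN -e opprB.
by move=> y z; apply/idP/idP; exact: sub.
Qed.

Lemma coker_eq_trans : transitive coker_eq.
Proof.
move=> z y t /asboolP[u eu] /asboolP[v ev]; apply/asboolP; exists (u + v).
by rewrite linearD -eu -ev addrA subrK.
Qed.

Canonical coker_equiv := EquivRel coker_eq coker_eq_refl coker_eq_sym coker_eq_trans.

Definition coker : Type := {eq_quot coker_equiv}.
HB.instance Definition _ := Choice.on coker.
HB.instance Definition _ := EqQuotient.on coker.

Definition coker_pi (y : Y) : coker := \pi_coker y.

Lemma coker_piP y z : coker_pi y = coker_pi z <-> exists x, y - z = d x.
Proof.
split=> [/eqP|e]; last apply/eqP;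
  rewrite -[_ == _]/(\pi_{eq_quot coker_equiv} _ == \pi_{eq_quot coker_equiv} _) eqmodE.
  by move=> /asboolP.
exact/asboolP.
Qed.

Lemma coker_piK (q : coker) : coker_pi (repr q) = q.
Proof. exact: reprK. Qed.

Lemma coker_ind (T : coker -> Prop) : (forall y, T (coker_pi y)) -> forall q, T q.
Proof. by move=> Tpi q; rewrite -(coker_piK q). Qed.

(** Operations on the cokernel and maps out of it are defined on chosen representatives; the choice
    matters only up to the image of [d]. *)
Lemma coker_repr y : exists x, repr (coker_pi y) = y + d x.
Proof.
have /coker_piP[x e] := coker_piK (coker_pi y).
by exists x; rewrite -e addrC subrK.
Qed.

Definition coker_add (q r : coker) : coker := coker_pi (repr q + repr r).
Definition coker_scale (a : S) (q : coker) : coker := coker_pi (a *: repr q).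
Definition coker_opp (q : coker) : coker := coker_scale (-1) q.

Lemma coker_piD' y z : coker_add (coker_pi y) (coker_pi z) = coker_pi (y + z).
Proof.
have [u eu] := coker_repr y; have [v ev] := coker_repr z.
by apply/coker_piP; exists (u + v); rewrite eu ev [RHS]linearD addrACA [LHS]addrC addKr.
Qed.

Lemma coker_piZ' a y : coker_scale a (coker_pi y) = coker_pi (a *: y).
Proof.
have [u eu] := coker_repr y; apply/coker_piP; exists (a *: u).
by rewrite eu scalerDr [RHS]linearZ [LHS]addrC addKr.
Qed.

Lemma coker_addA : associative coker_add.
Proof.
elim/coker_ind=> x; elim/coker_ind=> y; elim/coker_ind=> z.
by rewrite !coker_piD' addrA.
Qed.
Lemma coker_addC : commutative coker_add.
Proof. by elim/coker_ind=> x; elim/coker_ind=> y; rewrite !coker_piD' addrC. Qed.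
Lemma coker_add0 : left_id (coker_pi 0) coker_add.
Proof. by elim/coker_ind=> x; rewrite coker_piD' add0r. Qed.
Lemma coker_addN : left_inverse (coker_pi 0) coker_opp coker_add.
Proof. by elim/coker_ind=> x; rewrite /coker_opp coker_piZ' coker_piD' scaleN1r addNr. Qed.

HB.instance Definition _ :=
  GRing.isZmodule.Build coker coker_addA coker_addC coker_add0 coker_addN.

Lemma coker_piD : {morph coker_pi : y z / y + z}.
Proof. by move=> y z; rewrite -coker_piD'. Qed.

Lemma coker_scaleA a b q : coker_scale a (coker_scale b q) = coker_scale (a * b) q.
Proof. by elim/coker_ind: q => y; rewrite !coker_piZ' scalerA. Qed.
Lemma coker_scale1 : left_id 1 coker_scale.
Proof. by elim/coker_ind=> y; rewrite coker_piZ' scale1r. Qed.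
Lemma coker_scaleDr : right_distributive coker_scale +%R.
Proof.
move=> a; elim/coker_ind=> y; elim/coker_ind=> z.
by rewrite -coker_piD !coker_piZ' scalerDr coker_piD.
Qed.
Lemma coker_scaleDl q : {morph coker_scale^~ q : a b / a + b}.
Proof.
by move=> a b; elim/coker_ind: q => y; rewrite !coker_piZ' scalerDl coker_piD.
Qed.

HB.instance Definition _ := GRing.Zmodule_isLmodule.Build S coker
  coker_scaleA coker_scale1 coker_scaleDr coker_scaleDl.

Lemma coker_pi_linear : linear coker_pi.
Proof. by move=> a y z; rewrite coker_piD -coker_piZ'. Qed.

HB.instance Definition _ := GRing.isLinear.Build S Y coker _ coker_pi coker_pi_linear.

Lemma coker_pi_im x : coker_pi (d x) = 0.
Proof. by apply/coker_piP; exists x; rewrite subr0. Qed.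

Section Lift.
Variables (P : lmodType S) (f : {linear Y -> P}).
Hypothesis f_im : forall x, f (d x) = 0.

Definition coker_lift (q : coker) : P := f (repr q).

Lemma coker_liftE y : coker_lift (coker_pi y) = f y.
Proof.
by rewrite /coker_lift; have [x ->] := coker_repr y; rewrite linearD f_im addr0.
Qed.

Lemma coker_lift_linear : linear coker_lift.
Proof.
move=> a; elim/coker_ind=> y; elim/coker_ind=> z.
by rewrite -linearP !coker_liftE linearP.
Qed.

End Lift.

End Cokernel.

(* A map out of [htens B Y] that kills the image of [idfun (x) d] descends to
   [htens B (coker d)]; its linearity is inherited along the surjection
   [hmap idfun (coker_pi d)]. *)
Section TensorCokernel.
Variables (R : comPzRingType) (H : hopfAlgebra R).
Variables (B X Y P : lmodType H) (d : {linear X -> Y}) (f : {linear htens B Y -> P}).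
Hypothesis f_im : forall b x, f (hpure b (d x)) = 0.

Definition hcoker_lift (t : htens B (coker d)) : P :=
  tlift (fun (b : res B) (q : res (coker d)) => f (hpure b (repr (q : coker d))) : res P) t.

Lemma hcoker_lift_repr b y : f (hpure b (repr (coker_pi d y))) = f (hpure b y).
Proof. by have [x ->] := coker_repr d y; rewrite hpureDr linearD f_im addr0. Qed.

(** The tensor product is taken over [R], so forming the map needs only bilinearity over [R]. As [f]
    kills the image of [d] in the second factor, representatives can be replaced by the elements [y]
    and [z] themselves. *)
Lemma hcoker_lift_bil : bilinear_map
  (fun (b : res B) (q : res (coker d)) => f (hpure b (repr (q : coker d))) : res P).
Proof.
have lf := linear_comp (@htens_in_linear _ _ B Y) (res_linear (linear_lin f)).
have [b1 b2] := linear_bilinear (tpure_bilinear (res B) (res Y)) lf.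
split=> [q|b] a u v; first exact: b1.
elim/coker_ind: u => y; elim/coker_ind: v => z.
rewrite -[a *: _]/(alg_unit H a *: coker_pi d y) -linearP !hcoker_lift_repr.
exact: (b2 b a y z).
Qed.

Lemma hcoker_lift_pure b y : hcoker_lift (hpure b (coker_pi d y)) = f (hpure b y).
Proof. by rewrite /hcoker_lift (tlift_pure _ _ hcoker_lift_bil) hcoker_lift_repr. Qed.

Lemma hcoker_liftD : {morph hcoker_lift : s t / s + t}.
Proof. exact: lin_D (tlift_linear hcoker_lift_bil). Qed.

Lemma hcoker_lift_hmap t : hcoker_lift (hmap idfun (coker_pi d) t) = f t.
Proof.
elim/htens_ind: t => [b y|s t es et]; first by rewrite hmap_pure hcoker_lift_pure.
by rewrite !linearD hcoker_liftD es et.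
Qed.

Lemma hmap_coker_surj (t : htens B (coker d)) : exists s, t = hmap idfun (coker_pi d) s.
Proof.
elim/htens_ind: t => [b q|s t [s' ->] [t' ->]]; last by exists (s' + t'); rewrite linearD.
elim/coker_ind: q => y; exists (hpure b y).
by rewrite hmap_pure.
Qed.

Lemma hcoker_lift_linear : linear hcoker_lift.
Proof.
move=> h s t; have [s' ->] := hmap_coker_surj s; have [t' ->] := hmap_coker_surj t.
by rewrite -linearP !hcoker_lift_hmap linearP.
Qed.

End TensorCokernel.

(** * Extension of scalars, computed on elements *)

Section ExtensionOfScalars.
Variables (R : comPzRingType) (H : hopfAlgebra R).
Variables (A B M : lmodType H) (mul : {linear htens B B -> B}).
Variables (f : {linear A -> B}) (act : {linear htens A M -> M}).

Definition free_act : {linear htens B (htens B M) -> htens B M} :=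
  hmap mul idfun \o @hassoc_inv _ _ B B M.

Lemma free_act_pure b c m :
  free_act (hpure b (hpure c m)) = hpure (mul (hpure b c)) m.
Proof. by rewrite /= hassoc_inv_pure hmap_pure. Qed.

Definition ext_rel : {linear htens B (htens A M) -> htens B M} :=
  hmap idfun act \- (free_act \o hmap idfun (hmap f idfun)).

Lemma ext_rel_pure b a m : ext_rel (hpure b (hpure a m)) =
  hpure b (act (hpure a m)) - hpure (mul (hpure b (f a))) m.
Proof.
rewrite -[LHS]/(hmap idfun act _ - free_act (hmap idfun (hmap f idfun) _)).
by rewrite !hmap_pure -free_act_pure -(hmap_pure f idfun).
Qed.

Definition ext : lmodType H := coker ext_rel.

Definition ext_pi : {linear htens B M -> ext} := coker_pi ext_rel.

Lemma ext_piE b a m :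
  ext_pi (hpure b (act (hpure a m))) = ext_pi (hpure (mul (hpure b (f a))) m).
Proof.
apply/eqP; rewrite -subr_eq0 -linearB -ext_rel_pure; apply/eqP; exact: coker_pi_im.
Qed.

Lemma ext_ind (T : ext -> Prop) :
  (forall b m, T (ext_pi (hpure b m))) -> (forall s t, T s -> T t -> T (s + t)) ->
  forall t, T t.
Proof.
move=> Tpi TD; apply: coker_ind => y; elim/htens_ind: y => [b m|s t es et].
  exact: Tpi.
by rewrite linearD; exact: TD.
Qed.

(** Pure tensors generate additively, so a map balanced over [A] on them kills every relation. *)
Lemma ext_rel_ker (P : lmodType H) (g : {linear htens B M -> P}) :
  (forall b a m,
     g (hpure b (act (hpure a m))) = g (hpure (mul (hpure b (f a))) m)) ->
  forall x, g (ext_rel x) = 0.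
Proof.
move=> gE; elim/htens_ind=> [b t|s t es et]; last first.
  by rewrite (linearD ext_rel) (linearD g) es et addr0.
elim/htens_ind: t => [a m|s t es et]; last first.
  by rewrite (hpureDr b) (linearD ext_rel) (linearD g) es et addr0.
by rewrite ext_rel_pure linearB gE subrr.
Qed.

Hypothesis mulA : forall a b c,
  mul (hpure (mul (hpure a b)) c) = mul (hpure a (mul (hpure b c))).

Definition pi_free_act : {linear htens B (htens B M) -> ext} := ext_pi \o free_act.

Lemma pi_free_actE b c m :
  pi_free_act (hpure b (hpure c m)) = ext_pi (hpure (mul (hpure b c)) m).
Proof. by rewrite -free_act_pure. Qed.

(** Multiplying the relation for [c], [a], [m] by [b] gives the relation for [bc], [a], [m], by
    associativity in [B]. Hence the free action descends to the cokernel. *)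
Lemma pi_free_act_rel b x : pi_free_act (hpure b (ext_rel x)) = 0.
Proof.
elim/htens_ind: x => [c t|s t es et]; last first.
  by rewrite (linearD ext_rel) hpureDr (linearD pi_free_act) es et addr0.
elim/htens_ind: t => [a m|s t es et]; last first.
  by rewrite (hpureDr c) (linearD ext_rel) hpureDr (linearD pi_free_act) es et addr0.
rewrite ext_rel_pure.
(* The subtracted term is added to both sides, so that additivity of [hpure] suffices. *)
apply: (addIr (pi_free_act (hpure b (hpure (mul (hpure c (f a))) m)))).
rewrite -(linearD pi_free_act) -hpureDr subrK add0r !pi_free_actE.
by rewrite ext_piE mulA.
Qed.

Definition ext_act_fun : htens B ext -> ext := hcoker_lift pi_free_act.
HB.instance Definition _ := GRing.isLinear.Build H (htens B ext) ext _ ext_act_fun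
  (hcoker_lift_linear pi_free_act_rel).
Definition ext_act : {linear htens B ext -> ext} := ext_act_fun.

Lemma ext_act_pure b c m :
  ext_act (hpure b (ext_pi (hpure c m))) = ext_pi (hpure (mul (hpure b c)) m).
Proof.
rewrite -[LHS]/(hcoker_lift _ _) (hcoker_lift_pure pi_free_act_rel).
exact: pi_free_actE.
Qed.

Lemma ext_actA b c t :
  ext_act (hpure (mul (hpure b c)) t) = ext_act (hpure b (ext_act (hpure c t))).
Proof.
elim/ext_ind: t => [a m|s t es et]; first by rewrite !ext_act_pure mulA.
by rewrite !(hpureDr, linearD) es et.
Qed.

Section Unit.
Variable one : {linear hunit H -> B}.
Hypothesis mul1l : forall r b, mul (hpure (one r) b) = hlunit (hpure r b).
Hypothesis mul1r : forall r b, mul (hpure b (one r)) = hrunit (hpure b r).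

Lemma ext_act1 r t : ext_act (hpure (one r) t) = hlunit (hpure r t).
Proof.
elim/ext_ind: t => [b m|s t es et]; last by rewrite !(hpureDr, linearD) es et.
rewrite ext_act_pure mul1l !hlunit_pure.
(* The scalar [r] acts on [ext] through the unit of [H]; it is pulled back along [ext_pi],
   identified with the scalar of the tensor product over [R], and moved into the left factor. *)
rewrite [RHS]res_scaleE -linearZ -[_ *: hpure _ _]/(_ *: (_ : res (htens B M))) res_htens.
by rewrite -(lin_Z ((tpure_bilinear _ _).1 _)).
Qed.

(** This is the map sending m to the class of 1 ⊗ m; passing through the unit object makes it linear
    over [H] by construction. *)
Definition ext_unit : {linear M -> ext} := ext_pi \o (hmap one idfun \o @hlunit_inv _ _ M).

Lemma ext_unitE m : ext_unit m = ext_pi (hpure (one (1 : R)) m).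
Proof. by rewrite -[LHS]/(ext_pi (hmap _ _ (hpure _ _))) hmap_pure. Qed.

(** The image of [ext_unit] thus generates [ext] under the action of [B], which is what makes lifts
    unique. *)
Lemma ext_act_unit b m : ext_act (hpure b (ext_unit m)) = ext_pi (hpure b m).
Proof. by rewrite ext_unitE ext_act_pure mul1r hrunit_pure scale1r. Qed.

(** This is the defining relation of [ext] at b = 1. *)
Lemma ext_unit_act a m :
  ext_unit (act (hpure a m)) = ext_act (hpure (f a) (ext_unit m)).
Proof. by rewrite ext_act_unit ext_unitE ext_piE mul1l hlunit_pure scale1r. Qed.

Section Lift.
Variables (P : lmodType H) (actP : {linear htens B P -> P}) (g : {linear M -> P}).
Hypothesis actPA : forall b c p,
  actP (hpure (mul (hpure b c)) p) = actP (hpure b (actP (hpure c p))).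
Hypothesis actP1 : forall r p, actP (hpure (one r) p) = hlunit (hpure r p).
Hypothesis gE : forall a m, g (act (hpure a m)) = actP (hpure (f a) (g m)).

Definition free_lift : {linear htens B M -> P} := actP \o hmap idfun g.

Lemma free_lift_pure b m : free_lift (hpure b m) = actP (hpure b (g m)).
Proof. by rewrite -[LHS]/(actP (hmap _ _ _)) hmap_pure. Qed.

(** The map sending b ⊗ m to b g(m) is balanced: b g(am) = b (f(a) g(m)) = (b f(a)) g(m). *)
Lemma ext_lift_rel x : free_lift (ext_rel x) = 0.
Proof.
by apply: ext_rel_ker => b a m; rewrite !free_lift_pure gE actPA.
Qed.

Definition ext_lift_fun : ext -> P := coker_lift free_lift.
HB.instance Definition _ := GRing.isLinear.Build H ext P _ ext_lift_fun
  (coker_lift_linear ext_lift_rel).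
Definition ext_lift : {linear ext -> P} := ext_lift_fun.

Lemma ext_lift_pi b m : ext_lift (ext_pi (hpure b m)) = actP (hpure b (g m)).
Proof.
rewrite -[LHS]/(coker_lift _ _) (coker_liftE ext_lift_rel).
exact: free_lift_pure.
Qed.

Lemma ext_lift_act b t : ext_lift (ext_act (hpure b t)) = actP (hpure b (ext_lift t)).
Proof.
elim/ext_ind: t => [c m|s t es et]; last by rewrite !(hpureDr, linearD) es et.
by rewrite ext_act_pure !ext_lift_pi actPA.
Qed.

Lemma ext_lift_unit m : ext_lift (ext_unit m) = g m.
Proof. by rewrite ext_unitE ext_lift_pi actP1 hlunit_pure scale1r. Qed.

Lemma ext_lift_uniq (u : {linear ext -> P}) :
  (forall b t, u (ext_act (hpure b t)) = actP (hpure b (u t))) ->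
  (forall m, u (ext_unit m) = g m) -> u =1 ext_lift.
Proof.
move=> u_act u_unit; elim/ext_ind=> [b m|s t es et]; last by rewrite !linearD es et.
by rewrite ext_lift_pi -ext_act_unit u_act u_unit.
Qed.

End Lift.
End Unit.
End ExtensionOfScalars.

(** * Extension of scalars as a universal arrow among module objects *)

Section HModExtension.
Variables (R : comPzRingType) (H : hopfAlgebra R).
Local Notation V := (hmod_monoidal H).

Section Elements.
Variables (A : monoid_ob V) (L : module_ob A).
Let Ac : lmodType H := mon_car A.
Let Lc : lmodType H := mod_car L.
Let mul : {linear htens Ac Ac -> Ac} := mon_mul A.
Let one : {linear hunit H -> Ac} := mon_one A.
Let act : {linear htens Ac Lc -> Lc} := mod_act L.

(** Evaluating the diagrammatic axioms on pure tensors, here and in the next lemmas, yields the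
    elementwise hypotheses under which [ext] was studied. *)
Lemma mon_mulAE (a b c : Ac) :
  mul (hpure (mul (hpure a b)) c) = mul (hpure a (mul (hpure b c))).
Proof.
have := congr1 (fun F : {linear htens (htens Ac Ac) Ac -> Ac} =>
  F (hpure (hpure a b) c)) (mon_mulA A).
by rewrite /= hassoc_pure !hmap_pure.
Qed.

Lemma mon_mul1lE r (a : Ac) : mul (hpure (one r) a) = hlunit (hpure r a).
Proof.
have := congr1 (fun F : {linear htens (hunit H) Ac -> Ac} => F (hpure r a)) (mon_mul1l A).
by rewrite /= hmap_pure.
Qed.

Lemma mon_mul1rE r (a : Ac) : mul (hpure a (one r)) = hrunit (hpure a r).
Proof.
have := congr1 (fun F : {linear htens Ac (hunit H) -> Ac} => F (hpure a r)) (mon_mul1r A).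
by rewrite /= hmap_pure.
Qed.

Lemma mod_actAE (a b : Ac) (x : Lc) :
  act (hpure (mul (hpure a b)) x) = act (hpure a (act (hpure b x))).
Proof.
have := congr1 (fun F : {linear htens (htens Ac Ac) Lc -> Lc} =>
  F (hpure (hpure a b) x)) (mod_actA L).
by rewrite /= hassoc_pure !hmap_pure.
Qed.

Lemma mod_act1E r (x : Lc) : act (hpure (one r) x) = hlunit (hpure r x).
Proof.
have := congr1 (fun F : {linear htens (hunit H) Lc -> Lc} => F (hpure r x)) (mod_act1 L).
by rewrite /= hmap_pure.
Qed.

End Elements.

Lemma modh_actE (A : monoid_ob V) (L M : module_ob A) (g : module_hom L M)
    (a : mon_car A : lmodType H) (x : mod_car L : lmodType H) :
  (modh_hom g : {linear (mod_car L : lmodType H) -> (mod_car M : lmodType H)})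
    ((mod_act L : {linear htens _ _ -> _}) (hpure a x)) =
  (mod_act M : {linear htens _ _ -> _})
    (hpure a ((modh_hom g : {linear _ -> _}) x)).
Proof.
have := congr1
  (fun F : {linear htens (mon_car A : lmodType H) (mod_car L : lmodType H) ->
                   (mod_car M : lmodType H)} => F (hpure a x)) (modh_act g).
by rewrite /= hmap_pure.
Qed.

Section Extension.
Variables (A B : monoid_ob V) (f : monoid_hom A B) (M : module_ob A).
Let Ac : lmodType H := mon_car A.
Let Bc : lmodType H := mon_car B.
Let Mc : lmodType H := mod_car M.
Let mul : {linear htens Bc Bc -> Bc} := mon_mul B.
Let one : {linear hunit H -> Bc} := mon_one B.
Let act : {linear htens Ac Mc -> Mc} := mod_act M.
Let fc : {linear Ac -> Bc} := mh_hom f.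
Let E : lmodType H := ext mul fc act.
Let actE : {linear htens Bc E -> E} := ext_act fc act (@mon_mulAE B).

Let E_actA : (actE : @mor V _ _) ∘ (mon_mul B ⊠h idc (E : V)) =
  (actE : @mor V _ _) ∘ (idc (mon_car B) ⊠h (actE : @mor V _ _)) ∘ assoc _ _ _.
Proof.
apply/lin_eq/hext3l => b c t; rewrite /= hassoc_pure !hmap_pure.
exact: ext_actA.
Qed.

Let E_act1 : (actE : @mor V _ _) ∘ (mon_one B ⊠h idc (E : V)) = lunit (E : V).
Proof.
apply/lin_eq/htens_ext => r t; rewrite /= hmap_pure.
exact: (ext_act1 (@mon_mulAE B) (@mon_mul1lE B)).
Qed.

Definition hmod_ext : module_ob B :=
  @ModuleOb V B E actE E_actA E_act1.

Let unitE : {linear Mc -> E} := ext_unit mul fc act one.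

Let unitE_act : (unitE : @mor V Mc E) ∘ mod_act M =
  mod_act (restrict f hmod_ext) ∘ (idc (mon_car A) ⊠h (unitE : @mor V Mc E)).
Proof.
apply/lin_eq/htens_ext => a m; rewrite [RHS]/= !hmap_pure.
exact: (ext_unit_act fc act (@mon_mulAE B) (@mon_mul1lE B) (@mon_mul1rE B)).
Qed.

Definition hmod_ext_unit : module_hom M (restrict f hmod_ext) :=
  @ModuleHom V A M (restrict f hmod_ext) unitE unitE_act.

Lemma hmod_ext_universal (P : module_ob B) (g : module_hom M (restrict f P)) :
  exists! u : module_hom hmod_ext P,
    (u : mor hmod_ext P) ∘ (hmod_ext_unit : mor M hmod_ext) = g.
Proof.
pose Pc : lmodType H := mod_car P.
pose actP : {linear htens Bc Pc -> Pc} := mod_act P.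
pose gc : {linear Mc -> Pc} := modh_hom g.
(* The action on [restrict f P] is that of [P] precomposed with [f], so equivariance of [g] becomes
   semilinearity along [f]. *)
have gE a m : gc (act (hpure a m)) = actP (hpure (fc a) (gc m)).
  by rewrite [LHS](modh_actE g) /= hmap_pure.
pose u : {linear E -> Pc} := ext_lift (@mod_actAE B P) gE.
have u_act : (u : @mor V E Pc) ∘ mod_act hmod_ext =
    mod_act P ∘ (idc (mon_car B) ⊠h (u : @mor V E Pc)).
  apply/lin_eq/htens_ext => b t; rewrite [RHS]/= hmap_pure.
  exact: (ext_lift_act (@mon_mulAE B) (@mod_actAE B P) gE).
exists (@ModuleHom V B hmod_ext P u u_act); split.
  by apply/lin_eq => m; exact: (ext_lift_unit (@mod_actAE B P) (@mod_act1E B P) gE).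
move=> v vE; pose vc : {linear E -> Pc} := modh_hom v.
have v_act b t : vc (actE (hpure b t)) = actP (hpure b (vc t)).
  exact: (modh_actE v).
have v_unit m : vc (unitE m) = gc m.
  exact: (congr1 (fun F : {linear Mc -> Pc} => F m) vE).
apply: module_hom_eq; apply/lin_eq => t.
exact: esym (ext_lift_uniq (@mon_mul1rE B) (@mod_actAE B P) gE v_act v_unit t).
Qed.

End Extension.
End HModExtension.

Theorem lemma2 (R : comPzRingType) (H : hopfAlgebra R) (cH : cocommutative H) :
  is_fibration (rmod_proj (HMod cH)) /\ is_cofibration (rmod_proj (HMod cH)).
Proof.
split; first exact: strong_lifts_fibration (@rmod_strong_lifts _).
apply: strong_lifts_cofibration (@rmod_strong_lifts _) _.
apply: rmod_cocartesian_lifts => A B f M.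
(* The monoidal category underlying [HMod cH] is [hmod_monoidal H], where extension of scalars was
   built. *)
by exists (hmod_ext f M), (hmod_ext_unit f M); exact: hmod_ext_universal.
Qed.
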